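(* Let ${\bf X}_1,{\bf X}_2$ be $d$-dimensional real random vectors with characteristic functions $f_i({\bf t})=\mathbb E[e^{j{\bf t}^T{\bf X}_i}]$ that are $\delta$-dependent, and suppose ${\bf X}_1+{\bf X}_2$ and ${\bf X}_1-{\bf X}_2$ are $\epsilon$-dependent. Then for all $\epsilon+4\delta$ below some positive threshold there exist mean vectors $\widehat{\bf m}_1,\widehat{\bf m}_2\in\mathbb R^d$ and a common symmetric positive semi-definite matrix $\widehat{\bf Q}$ such that, with $\Phi_i({\bf t})=e^{{\bf t}^T(j\widehat{\bf m}_i-\frac12\widehat{\bf Q}{\bf t})}$, $$|f_i({\bf t})-\Phi_i({\bf t})|\le\tilde C(\epsilon+4\delta)\quad\text{for all }{\bf t}\in\mathbb R^d,\ i=1,2,$$ for a constant $\tilde C$ independent of $\epsilon+4\delta$ and ${\bf t}$. In particular, if $\epsilon=\delta=0$ then ${\bf X}_1$ and ${\bf X}_2$ are Gaussian with the same covariance matrix.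
   Context: $j=\sqrt{-1}$. Random vectors ${\bf U}_1,{\bf U}_2$ are $\epsilon$-dependent if $|\mathbb E[e^{j{\bf t}_1^T{\bf U}_1+j{\bf t}_2^T{\bf U}_2}]-\mathbb E[e^{j{\bf t}_1^T{\bf U}_1}]\mathbb E[e^{j{\bf t}_2^T{\bf U}_2}]|\le\epsilon$ for all ${\bf t}_1,{\bf t}_2$; $0$-dependence is equivalent to independence. *)

(* Defs.v *)
From mathcomp Require Import all_boot all_algebra all_classical all_reals all_analysis.
From mathcomp Require Import complex.
Import GRing.Theory Num.Theory.
Local Open Scope ring_scope.
Local Open Scope complex_scope.

Definition dotv {R : ringType} {d : nat} (t x : 'rV[R]_d) : R :=
  \sum_(k < d) t ord0 k * x ord0 k.

Definition rand_vec {dT : measure_display} {T : measurableType dT}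
  {R : realType} (d : nat) (X : T -> 'rV[R]_d) : Prop :=
  forall k : 'I_d, measurable_fun setT (fun w => X w ord0 k).

(* E[exp(j s)] for a real random variable s, as E[cos s] + j E[sin s]. *)
Definition cexpect {dT : measure_display} {T : measurableType dT}
  {R : realType} (P : probability T R) (s : T -> R) : R[i] :=
  (Rintegral P setT (fun w => cos (s w))) +i* (Rintegral P setT (fun w => sin (s w))).

Definition charfun {dT : measure_display} {T : measurableType dT}
  {R : realType} (P : probability T R) {d : nat} (X : T -> 'rV[R]_d)
  (t : 'rV[R]_d) : R[i] :=
  cexpect P (fun w => dotv t (X w)).

Definition eps_dependent {dT : measure_display} {T : measurableType dT}
  {R : realType} (P : probability T R) {d1 d2 : nat}
  (eps : R) (U1 : T -> 'rV[R]_d1) (U2 : T -> 'rV[R]_d2) : Prop :=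
  forall (t1 : 'rV[R]_d1) (t2 : 'rV[R]_d2),
    `| cexpect P (fun w => dotv t1 (U1 w) + dotv t2 (U2 w))
       - charfun P U1 t1 * charfun P U2 t2 | <= eps%:C.

(* Gaussian characteristic function exp(t^T (j m - 1/2 Q t))
   = exp(-1/2 t^T Q t) (cos (t^T m) + j sin (t^T m)). *)
Definition gauss_cf {R : realType} {d : nat} (m : 'rV[R]_d) (Q : 'M[R]_d)
  (t : 'rV[R]_d) : R[i] :=
  let a := expR (- (1/2) * (t *m Q *m t^T) ord0 ord0) in
  (a * cos (dotv t m)) +i* (a * sin (dotv t m)).

Definition sym_psd {R : realType} {d : nat} (Q : 'M[R]_d) : Prop :=
  Q^T = Q /\ forall v : 'rV[R]_d, 0 <= (v *m Q *m v^T) ord0 ord0.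

(* Main.v *)
Require Import Defs.
From mathcomp Require Import all_boot all_order all_algebra all_fingroup.
From mathcomp Require Import all_classical all_reals all_analysis.
From mathcomp Require Import complex measurable_realfun ring lra.
Import Order.TTheory GRing.Theory Num.Theory Normc numFieldNormedType.Exports.
Set Implicit Arguments.
Unset Strict Implicit.
Unset Printing Implicit Defensive.
Local Open Scope ring_scope.
Local Open Scope complex_scope.

(** Write [eta = eps + 4 * delta].  The two dependence hypotheses combine into
    [f1 (s + t) * f2 (s - t) ~ f1 s * f2 s * (f1 t * f2 (- t))] up to [eta].  The products
    [F t = f1 t * f2 t] and [H t = f1 t * f2 (- t)] have the same modulus [h] and both satisfy
    [F (s + t) * F (s - t) ~ F s ^ 2 * h t ^ 2], while [f1 (2 t) ~ F t * H t] and
    [f2 (2 t) ~ F t * conj (H t)].  So it suffices to fit [F] and [H] by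
    [exp (- t A t^T + i m t)] with a common [A].

    Where [h >= 1/2], [- ln h] almost satisfies the parallelogram law and [F / h] is almost a
    character; both are fitted on a box, because a bounded almost additive function on a box is
    almost linear.  The box is adapted to [h] by an Auerbach basis of the set where [h >= 1/2],
    which makes all constants depend on the dimension only.  Beyond the box the error propagates through
    [F (2 t) ~ F t ^ 2 * h t ^ 2], which is contracting once [h] is small.

    The superlevel set of [h] has to be bounded for this; multiplying [f1] and [f2] by
    [exp (- sigma |t|^2)] achieves it without changing [eta], and the parameters found for
    [sigma -> 0] are bounded and have a cluster point. *)

(** The threshold and the constant are fixed before the probability space, so neither may depend on
    the scale or the shape of the distributions. A doubling of the argument can multiply the error
    by four while the moduli are near one, so the number of doublings between the fitted box and the
    region where [h] is below [1/2] has to be bounded in terms of [d]; yet the set where [h >= 1/2]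
    may be arbitrarily long in one direction and thin in another. Boundedness of that set and
    continuity at the origin are used only qualitatively. The fits on the box yield a symmetric [A]
    without a sign; semi-definiteness comes from the fact that [h] does drop below [1/2] along every
    ray. For a distribution carried by a hyperplane the modulus is [1] along a whole line, and there
    the recursion never contracts: this is the obstacle that the damping removes. The products [F]
    and [H] are formed because the equation for the pair couples two unknown functions, while each
    product satisfies an equation of its own with defect at most [2 * eta]. *)

(** * Moduli of complex numbers and points of the unit circle *)

Lemma normc_ge0 (R : realType) (z : R[i]) : 0 <= normc z.
Proof. by case: z => a b; rewrite /normc sqrtr_ge0. Qed.

Lemma normc_real (R : realType) (a : R) : normc a%:C = `|a|.
Proof. by rewrite /= expr0n /= addr0 sqrtr_sqr. Qed.

Lemma normc_sub (R : realType) (x y : R[i]) : normc (x - y) = normc (y - x).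
Proof. by rewrite -opprB normcN. Qed.

Lemma normc_dist (R : realType) (y x z : R[i]) :
  normc (x - z) <= normc (x - y) + normc (y - z).
Proof. by have := le_normcD (x - y) (y - z); rewrite addrA subrK. Qed.

Lemma ler_normc_dist (R : realType) (x y : R[i]) :
  `|normc x - normc y| <= normc (x - y).
Proof.
have h (u v : R[i]) : normc u - normc v <= normc (u - v).
  by rewrite lerBlDr; have := normc_dist v u 0; rewrite !subr0.
by rewrite ler_norml h andbT lerNl opprB normc_sub h.
Qed.

Lemma normcX (R : realType) (x : R[i]) n : normc (x ^+ n) = normc x ^+ n.
Proof. by elim: n => [|n IH]; rewrite ?expr0 ?normc1 // !exprS normcM IH. Qed.

Lemma normc_conj (R : realType) (x : R[i]) : normc (conjc x) = normc x.
Proof. by case: x => a b /=; rewrite sqrrN. Qed.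

Lemma normcM_dist (R : realType) (a b c d : R[i]) :
  normc (a * b - c * d) <= normc (a - c) * normc b + normc c * normc (b - d).
Proof.
rewrite -!normcM; have -> : a * b - c * d = (a - c) * b + c * (b - d) by ring.
exact: le_normcD.
Qed.

Lemma normcM_dist_le1 (R : realType) (a b c d : R[i]) (e1 e2 : R) :
  normc b <= 1 -> normc c <= 1 -> normc (a - c) <= e1 -> normc (b - d) <= e2 ->
  normc (a * b - c * d) <= e1 + e2.
Proof.
move=> hb hc h1 h2; apply: (le_trans (normcM_dist _ _ _ _)); apply: lerD.
  by rewrite -[e1]mulr1 ler_pM ?normc_ge0.
by rewrite -[e2]mul1r ler_pM ?normc_ge0.
Qed.

Lemma normc_Im (R : realType) (z : R[i]) : `|complex.Im z| <= normc z.
Proof.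
by case: z => a b /=; rewrite -sqrtr_sqr ler_wsqrtr // lerDr sqr_ge0.
Qed.

Lemma normc_Re (R : realType) (z : R[i]) : `|complex.Re z| <= normc z.
Proof.
by case: z => a b /=; rewrite -sqrtr_sqr ler_wsqrtr // lerDl sqr_ge0.
Qed.

Lemma normc_leD (R : realType) (a b : R) : normc (a +i* b) <= `|a| + `|b|.
Proof.
have -> : a +i* b = a%:C + 0 +i* b :> R[i] by simpc.
by apply: (le_trans (le_normcD _ _)); rewrite normc_real /= expr0n /= add0r sqrtr_sqr.
Qed.

Definition expi {R : realType} (x : R) : R[i] := cos x +i* sin x.

Lemma expiD (R : realType) (x y : R) : expi (x + y) = expi x * expi y.
Proof. by rewrite /expi cosD sinD; simpc; congr (_ +i* _); rewrite addrC mulrC. Qed.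

Lemma expi0 (R : realType) : expi (0 : R) = 1.
Proof. by rewrite /expi cos0 sin0. Qed.

Lemma normc_expi (R : realType) (x : R) : normc (expi x) = 1.
Proof. by rewrite /= cos2Dsin2 sqrtr1. Qed.

Lemma conj_expi (R : realType) (x : R) : conjc (expi x) = expi (- x).
Proof. by rewrite /expi cosN sinN. Qed.

Lemma sin_le_id (R : realType) (x : R) : 0 <= x -> sin x <= x.
Proof.
rewrite le_eqVlt => /predU1P[<-|x0]; first by rewrite sin0.
have [c _ ] := MVT x0 (fun y _ => is_derive_sin y)
  (continuous_subspaceT (@continuous_sin R)).
by rewrite sin0 !subr0 => ->; rewrite ler_piMl ?cos_le1 // ltW.
Qed.

Lemma normr_sin_le (R : realType) (x : R) : `|sin x| <= `|x|.
Proof.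
wlog x0 : x / 0 <= x => [H|].
  by case: (lerP 0 x) => [/H //|/ltW]; rewrite -oppr_ge0 => /H; rewrite sinN !normrN.
rewrite (ger0_norm x0); case: (lerP x (pi / 2)) => hx.
  rewrite ger0_norm ?sin_le_id // sin_ge0_pi // x0 /= (le_trans hx) //.
  by have := pi_ge0 R; lra.
apply: (le_trans (sin_max _)); apply: (le_trans _ (ltW hx)); exact: pihalf_ge1.
Qed.

Lemma cos_lb (R : realType) (x : R) : 1 - x ^+ 2 / 2 <= cos x.
Proof.
have -> : x = (x / 2) *+ 2 by rewrite mulr2n; field.
rewrite cos_mulr2n cos2sin2.
have : sin (x / 2) ^+ 2 <= (x / 2) ^+ 2.
  rewrite -(real_normK (num_real (sin (x / 2)))) -(real_normK (num_real (x / 2))).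
  by rewrite lerXn2r ?nnegrE ?normr_sin_le.
rewrite !mulr2n; set s := sin _ ^+ 2; set y := x / 2 => h.
have -> : (y + y) ^+ 2 / 2 = 2 * y ^+ 2 by field.
lra.
Qed.

Lemma sin_lb (R : realType) (x : R) : `|x| <= 1 -> `|x| / 2 <= `|sin x|.
Proof.
wlog x0 : x / 0 <= x => [H|].
  by case: (lerP 0 x) => [/H //|/ltW]; rewrite -oppr_ge0 => /H; rewrite sinN !normrN.
rewrite (ger0_norm x0) => x1.
apply: (le_trans _ (ler_norm _)).
move: x0; rewrite le_eqVlt => /predU1P[<-|x0]; first by rewrite mul0r sin0.
have [c ] := MVT x0 (fun y _ => is_derive_sin y)
  (continuous_subspaceT (@continuous_sin R)).
rewrite in_itv /= sin0 !subr0 => /andP[c0 cx] ->.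
rewrite mulrC ler_wpM2r ?(ltW x0) //.
apply: (le_trans _ (cos_lb c)).
have : c ^+ 2 <= 1 by rewrite expr_le1 // ?(ltW c0) //; lra.
lra.
Qed.

(** The bound on [x] selects the branch: [expi x] is also near [1] when [x] is near a nonzero
    multiple of [2 * pi]. *)
Lemma expi_near1 (R : realType) (x e : R) :
  `|x| <= 1 -> normc (expi x - 1) <= e -> `|x| <= 2 * e.
Proof.
move=> /sin_lb h1 h2; have := le_trans (normc_Im _) h2.
rewrite /expi raddfB /= subr0 => h3; lra.
Qed.

Lemma normc_expi_dist (R : realType) (x y : R) : normc (expi x - expi y) <= 2 * `|x - y|.
Proof.
have -> : expi x - expi y = expi y * (expi (x - y) - 1).
  by rewrite mulrBr mulr1 -expiD (addrC y) subrK.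
rewrite normcM normc_expi mul1r; set z := x - y.
have -> : z = z / 2 + z / 2 by field.
move: (z / 2) => w; have -> : expi (w + w) - 1 = expi w * (2 * sin w)%:C * 'i.
  have h : cos w ^+ 2 = 1 - sin w ^+ 2 by rewrite -(cos2Dsin2 w) addrK.
  rewrite /expi cosD sinD (_ : (1 : R[i]) = 1 +i* 0) //; simpc.
  by congr (_ +i* _); ring: h.
rewrite !normcM normc_expi mul1r normc_real /= expr0n expr1n /= add0r sqrtr1 mulr1.
rewrite normrM (ger0_norm (ler0n _ 2)) ler_pM2l ?ltr0n //.
apply: (le_trans (normr_sin_le _)).
by rewrite -mulr2n -mulr_natl normrM normr_nat ler_peMl // ler1n.
Qed.

(** The real part is positive, so the arcsine of the imaginary part is an angle. The bound [1 / 4]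
    keeps a combination of three such angles below [1], as [expi_near1] requires. *)
Lemma exists_angle (R : realType) (z : R[i]) :
  normc z = 1 -> normc (z - 1) <= 1 / 8 ->
  exists2 th : R, z = expi th & `|th| <= 1 / 4.
Proof.
case: z => a b z1 hz.
have hb : `|b| <= 1 / 8.
  by apply: le_trans hz; have := normc_Im ((a +i* b) - 1); rewrite raddfB /= subr0.
have ha : `|a - 1| <= 1 / 8.
  by apply: le_trans hz; have := normc_Re ((a +i* b) - 1); rewrite raddfB /=.
move: hb ha; rewrite !ler_norml => /andP[hb1 hb2] /andP[ha1 ha2].
have bI : -1 <= b <= 1 by lra.
have ab : a ^+ 2 + b ^+ 2 = 1.
  by rewrite -[LHS]sqr_sqrtr ?addr_ge0 ?sqr_ge0 // -[RHS](expr1n _ 2); congr (_ ^+ 2).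
exists (asin b).
  rewrite /expi cos_asin // asinK ?in_itv //=; congr (_ +i* _).
  have -> : 1 - b ^+ 2 = a ^+ 2 by rewrite -ab addrK.
  by rewrite sqrtr_sqr ger0_norm //; lra.
have p2 := pihalf_ge1 R.
have qI : (1 / 4 : R) \in `[- (pi / 2), pi / 2] by rewrite in_itv /=; lra.
have qNI : (- (1 / 4) : R) \in `[- (pi / 2), pi / 2] by rewrite in_itv /=; lra.
have tI : asin b \in `[- (pi / 2), pi / 2].
  by rewrite in_itv /= asin_geNpi2 // asin_lepi2.
have s4 : 1 / 8 <= sin (1 / 4 : R).
  have := @sin_lb R (1 / 4); rewrite ger0_norm; last by lra.
  rewrite ger0_norm; last by apply: sin_ge0_pi; lra.
  by move=> H; have := H ltac:(lra); lra.
have sb : sin (asin b) = b by rewrite asinK ?in_itv.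
rewrite ler_norml; apply/andP; split; rewrite leNgt; apply/negP => h.
  by move: h; rewrite -ltr_sin // sb sinN; lra.
by move: h; rewrite -ltr_sin // sb; lra.
Qed.

(** * Almost additive functions on a box *)

Lemma exists_exp2_gt (R : realType) (x : R) : exists n, x < 2 ^+ n.
Proof.
exists (Num.bound `|x|); apply: (le_lt_trans (ler_norm _)); apply: (lt_trans (archi_boundP (normr_ge0 _))).
  by rewrite -natrX ltr_nat ltn_expl.
Qed.

Lemma le_geometric (R : realType) (a b M : R) :
  0 <= M -> (forall n, a <= b + M / 2 ^+ n) -> a <= b.
Proof.
move=> M0 H; rewrite leNgt; apply/negP => ba.
have [n hn] := exists_exp2_gt (M / (a - b)).
have := H n; rewrite leNgt => /negP; apply.
rewrite -ltrBrDl ltr_pdivrMr ?exprn_gt0 //.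
by rewrite ltr_pdivrMr ?subr_gt0 // mulrC in hn.
Qed.

(** The bound [M] is qualitative and disappears: doubling, together with a shift by [1], where [r]
    vanishes, turns a bound [N] into [(N + 3 * e) / 2], whose fixed point is [3 * e]. *)
Lemma approx_additive1 (R : realType) (r : R -> R) (e M : R) :
  (forall x, `|x| <= 1 -> `|r x| <= M) ->
  (forall x y, `|x| <= 1 -> `|y| <= 1 -> `|x + y| <= 1 ->
    `|r (x + y) - r x - r y| <= e) ->
  r 1 = 0 -> forall x, `|x| <= 1 -> `|r x| <= 3 * e.
Proof.
move=> rM rD r1.
have e0 : 0 <= e.
  by apply: (le_trans (normr_ge0 (r (0 + 0) - r 0 - r 0))); apply: rD; rewrite ?addr0 normr0.
have M0 : 0 <= M by apply: (le_trans (normr_ge0 (r 0))); apply: rM; rewrite normr0.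
have half N : (forall x, `|x| <= 1 -> `|r x| <= N) ->
    forall x, `|x| <= 1 -> `|r x| <= (N + 3 * e) / 2.
  move=> rN x; rewrite ler_norml => /andP[x1 x2].
  have double y : `|y| <= 1 / 2 -> `|r y| <= (N + e) / 2.
    rewrite ler_norml => /andP[y1 y2].
    have hy : `|y| <= 1 by rewrite ler_norml; lra.
    have hyy : `|y + y| <= 1 by rewrite ler_norml; lra.
    have := rD _ _ hy hy hyy; have := rN _ hyy.
    rewrite !ler_norml => /andP[? ?] /andP[? ?]; apply/andP; split; lra.
  case: (lerP x (- (1 / 2))) => [hx|hx].
    have hy : `|x + 1| <= 1 / 2 by rewrite ler_norml; lra.
    have := rD x 1 ltac:(rewrite ler_norml; lra) ltac:(rewrite ler_norml; lra)
      ltac:(rewrite ler_norml; lra).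
    have := double _ hy; rewrite r1 !ler_norml => /andP[? ?] /andP[? ?]; lra.
  case: (lerP x (1 / 2)) => [hx'|hx'].
    have hy : `|x| <= 1 / 2 by rewrite ler_norml; lra.
    have := double _ hy; rewrite !ler_norml => /andP[? ?]; lra.
  have hy : `|1 - x| <= 1 / 2 by rewrite ler_norml; lra.
  have := rD x (1 - x) ltac:(rewrite ler_norml; lra) ltac:(rewrite ler_norml; lra)
      ltac:(rewrite ler_norml; lra).
  rewrite (_ : x + (1 - x) = 1); last by ring.
  have := double _ hy; rewrite r1 !ler_norml => /andP[? ?] /andP[? ?]; lra.
have iter n : forall x, `|x| <= 1 -> `|r x| <= 3 * e + M / 2 ^+ n.
  elim: n => [|n IH] x hx.
    rewrite expr0 divr1; have := rM _ hx; lra.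
  apply: (le_trans (half _ IH _ hx)); rewrite exprS.
  have -> : M / (2 * 2 ^+ n) = (M / 2 ^+ n) / 2.
    by rewrite invfM mulrCA mulrC.
  lra.
by move=> x hx; apply: (@le_geometric _ _ _ M) => // n; apply: iter.
Qed.

Definition inbox {R : realType} {d : nat} (r : R) (x : 'rV[R]_d) : bool :=
  [forall i, `|x ord0 i| <= r].

Lemma inboxP (R : realType) (d : nat) (r : R) (x : 'rV[R]_d) :
  reflect (forall i, `|x ord0 i| <= r) (inbox r x).
Proof. exact: forallP. Qed.

Lemma inboxD (R : realType) (d : nat) (r s : R) (x y : 'rV[R]_d) :
  inbox r x -> inbox s y -> inbox (r + s) (x + y).
Proof.
move=> /inboxP hx /inboxP hy; apply/inboxP => i; rewrite mxE.
by apply: (le_trans (ler_normD _ _)); apply: lerD.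
Qed.

Lemma inboxN (R : realType) (d : nat) (r : R) (x : 'rV[R]_d) :
  inbox r (- x) = inbox r x.
Proof. by apply: eq_forallb => i; rewrite mxE normrN. Qed.

Lemma inboxZ (R : realType) (d : nat) (r c : R) (x : 'rV[R]_d) :
  inbox r x -> inbox (`|c| * r) (c *: x).
Proof.
by move=> /inboxP hx; apply/inboxP => i; rewrite mxE normrM ler_wpM2l.
Qed.

Lemma inboxW (R : realType) (d : nat) (r s : R) (x : 'rV[R]_d) :
  r <= s -> inbox r x -> inbox s x.
Proof. by move=> rs /inboxP hx; apply/inboxP => i; apply: (le_trans (hx i)). Qed.

Lemma inbox0 (R : realType) (d : nat) (r : R) : 0 <= r -> inbox r (0 : 'rV[R]_d).
Proof. by move=> r0; apply/inboxP => i; rewrite mxE normr0. Qed.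

Definition evec {R : realType} {d : nat} (i : 'I_d) : 'rV[R]_d := delta_mx ord0 i.

Lemma inbox_evec (R : realType) (d : nat) (c r : R) (i : 'I_d) :
  `|c| <= r -> inbox r (c *: evec i).
Proof.
move=> cr; apply/inboxP => j; rewrite !mxE eqxx /=; case: eqP => _.
  by rewrite mulr1.
by rewrite mulr0 normr0 (le_trans (normr_ge0 c)).
Qed.

(** Partial sums of the coordinate expansion; they stay in every box that contains [x]. *)
Definition row_trunc {R : realType} {d : nat} (x : 'rV[R]_d) (k : nat) : 'rV[R]_d :=
  \row_i (if (i < k)%N then x ord0 i else 0).

Lemma row_trunc0 (R : realType) (d : nat) (x : 'rV[R]_d) : row_trunc x 0 = 0.
Proof. by apply/rowP => i; rewrite !mxE. Qed.

Lemma row_trunc_full (R : realType) (d : nat) (x : 'rV[R]_d) : row_trunc x d = x.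
Proof. by apply/rowP => i; rewrite !mxE ltn_ord. Qed.

Lemma row_truncS (R : realType) (d : nat) (x : 'rV[R]_d) (k : 'I_d) :
  row_trunc x k.+1 = row_trunc x k + x ord0 k *: evec k.
Proof.
apply/rowP => i; rewrite !mxE eqxx /= ltnS leq_eqVlt -val_eqE /=.
case: eqP => [/val_inj ->|_] /=; first by rewrite ltnn mulr1 add0r.
by rewrite mulr0 addr0.
Qed.

Lemma inbox_trunc (R : realType) (d : nat) (r : R) (x : 'rV[R]_d) k :
  0 <= r -> inbox r x -> inbox r (row_trunc x k).
Proof.
move=> r0 /inboxP hx; apply/inboxP => i; rewrite mxE; case: ifP => _ //.
by rewrite normr0.
Qed.

(** Each new coordinate costs [3 * e] for linearity along its axis and [e] for additivity; [a 0]
    costs one more [e]. *)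
Lemma approx_additive_box (R : realType) (d : nat) (a : 'rV[R]_d -> R) (e M : R) :
  (forall x, inbox 1 x -> `|a x| <= M) ->
  (forall x y, inbox 1 x -> inbox 1 y -> inbox 1 (x + y) ->
    `|a (x + y) - a x - a y| <= e) ->
  forall x, inbox 1 x ->
  `|a x - \sum_i x ord0 i * a (evec i)| <= (4 * d.+1)%:R * e.
Proof.
move=> aM aD x hx.
have e0 : 0 <= e.
  apply: (le_trans (normr_ge0 (a (0 + 0) - a 0 - a 0))).
  by apply: aD; rewrite ?addr0 inbox0.
have lin1 (i : 'I_d) (c : R) : `|c| <= 1 -> `|a (c *: evec i) - c * a (evec i)| <= 3 * e.
  move: c; apply: (@approx_additive1 R _ e (M + M)) => [c hc|c c' h1 h2 h3|].
  - apply: (le_trans (ler_normB _ _)); apply: lerD; first by apply: aM; apply: inbox_evec.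
    rewrite normrM -[M]mul1r ler_pM //; apply: aM.
    by rewrite -[evec i]scale1r; apply: inbox_evec; rewrite normr1.
  - have := aD (c *: evec i) (c' *: evec i); rewrite -scalerDl.
    move=> /(_ (inbox_evec _ h1) (inbox_evec _ h2) (inbox_evec _ h3)).
    by congr (`|_| <= _); ring.
  - by rewrite scale1r mul1r subrr.
have part k : (k <= d)%N ->
    `|a (row_trunc x k) - \sum_(i < d | (i < k)%N) x ord0 i * a (evec i)| <= (4 * k.+1)%:R * e.
  elim: k => [|k IH] kd.
    rewrite big1 ?subr0 // row_trunc0 /=.
    have := aD 0 0; rewrite !addr0 => /(_ (inbox0 _ ler01) (inbox0 _ ler01) (inbox0 _ ler01)).
    rewrite subrr sub0r normrN => h; apply: (le_trans h).
    by rewrite ler_peMl // ler1n.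
  rewrite (bigD1 (Ordinal kd)) //= (eq_bigl (fun i : 'I_d => (i < k)%N)); last first.
    by move=> i; rewrite -val_eqE /= ltnS ltn_neqAle andbC.
  have tk := row_truncS x (Ordinal kd); rewrite /= in tk.
  have := aD (row_trunc x k) (x ord0 (Ordinal kd) *: evec (Ordinal kd)).
  rewrite -tk => /(_ (inbox_trunc _ ler01 hx)) H.
  have xk : `|x ord0 (Ordinal kd)| <= 1 by move/inboxP: hx.
  have := H (inbox_evec _ xk) (inbox_trunc _ ler01 hx).
  have := lin1 (Ordinal kd) _ xk; have := IH (ltnW kd).
  set S := \sum_(i < d | _) _; rewrite !mulnS !natrD.
  move: (a (row_trunc x k.+1)) (a (row_trunc x k)) (a (_ *: _)) (_ * a (evec _)).
  move=> a1 a2 a3 a4.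
  rewrite !ler_norml => /andP[? ?] /andP[? ?] /andP[? ?]; apply/andP; split; lra.
have := part d (leqnn d); rewrite row_trunc_full (eq_bigl xpredT) // => i.
exact: ltn_ord.
Qed.

(** * Almost quadratic functions and almost characters on a box *)

(** Jordan and von Neumann's polarisation with errors: [B] is almost additive in each variable,
    hence almost bilinear. The box of radius [4] has room for sums of three vectors of the unit
    box. *)
Lemma approx_quadratic_box (R : realType) (d : nat) (q : 'rV[R]_d -> R) (e M : R) :
  (forall x, inbox 4 x -> `|q x| <= M) ->
  (forall x, q (- x) = q x) ->
  (forall s t, inbox 4 s -> inbox 4 t -> inbox 4 (s + t) -> inbox 4 (s - t) ->
    `|q (s + t) + q (s - t) - 2 * q s - 2 * q t| <= e) ->
  exists2 A : 'M[R]_d, A^T = A & forall x, inbox 1 x ->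
    `|q x - (x *m A *m x^T) ord0 ord0| <= (5 * d.+1 ^ 2)%:R * e.
Proof.
move=> qM qN qD.
pose B s t := q (s + t) - q (s - t).
have BC s t : B s t = B t s by rewrite /B (addrC s) -(qN (s - t)) opprB.
have B0 t : B 0 t = 0 by rewrite /B add0r sub0r qN subrr.
have box4 n (x : 'rV[R]_d) : (n <= 4)%N -> inbox n%:R x -> inbox 4 x.
  by move=> n4; apply: inboxW; rewrite ler_nat.
have e0 : 0 <= e.
  have h0 : inbox 4 (0 : 'rV[R]_d) := inbox0 _ (ler0n _ 4).
  have := qD 0 0 h0 h0; rewrite subr0 addr0 => /(_ h0 h0).
  by apply: le_trans; apply: normr_ge0.
have jensen s s' t : inbox 1 s -> inbox 1 s' -> inbox 1 t ->
    `|B (s + s') t + B (s - s') t - 2 * B s t| <= 2 * e.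
  move=> hs hs' ht.
  have hNs' : inbox 1 (- s') by rewrite inboxN.
  have hNt : inbox 1 (- t) by rewrite inboxN.
  have step u : inbox 1 u ->
      `|q (s + s' + u) + q (s - s' + u) - 2 * q (s + u) - 2 * q s'| <= e.
    move=> hu; rewrite (addrAC s s') (addrAC s (- s')).
    apply: qD.
    - exact: (@box4 2 _ _ (inboxD hs hu)).
    - exact: (@box4 1).
    - by apply: (inboxW _ (inboxD (inboxD hs hu) hs')); lra.
    - by apply: (inboxW _ (inboxD (inboxD hs hu) hNs')); lra.
  have := step _ ht; have := step _ hNt; rewrite /B.
  rewrite !ler_norml => /andP[? ?] /andP[? ?]; apply/andP; split; lra.
have addB t x y : inbox 1 t -> inbox 1 x -> inbox 1 y ->
    `|B (x + y) t - B x t - B y t| <= 4 * e.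
  move=> ht hx hy.
  (* With [x = s + s'] and [y = s - s'], the estimate [jensen] at [s, s'] is compared with the one
     at [s, s], where [B 0 t] vanishes. *)
  pose s := 2^-1 *: (x + y); pose s' := 2^-1 *: (x - y).
  have h2 : `|2^-1 : R| * (1 + 1) = 1.
    by rewrite ger0_norm ?invr_ge0 ?ler0n // mulVf // pnatr_eq0.
  have hs : inbox 1 s by have := inboxZ 2^-1 (inboxD hx hy); rewrite h2.
  have hs' : inbox 1 s'.
    by have := inboxZ 2^-1 (inboxD hx (_ : inbox 1 (- y))); rewrite h2 inboxN => /(_ hy).
  have ss' : s + s' = x.
    by apply/rowP => i; rewrite !mxE; field.
  have sBs' : s - s' = y.
    by apply/rowP => i; rewrite !mxE; field.
  have ss : s + s = x + y.
    by apply/rowP => i; rewrite !mxE; field.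
  have := jensen _ _ _ hs hs' ht; have := jensen _ _ _ hs hs ht.
  rewrite ss' sBs' ss subrr B0.
  rewrite !ler_norml => /andP[? ?] /andP[? ?]; apply/andP; split; lra.
have BM t x : inbox 1 t -> inbox 1 x -> `|B x t| <= M + M.
  move=> ht hx; have hNt : inbox 1 (- t) by rewrite inboxN.
  apply: (le_trans (ler_normB _ _)); apply: lerD; apply: qM.
    exact: (@box4 2 _ _ (inboxD hx ht)).
  exact: (@box4 2 _ _ (inboxD hx hNt)).
have linB t x : inbox 1 t -> inbox 1 x ->
    `|B x t - \sum_i x ord0 i * B (evec i) t| <= (4 * d.+1)%:R * (4 * e).
  move=> ht; apply: (approx_additive_box (fun y => BM t y ht)).
  by move=> y z hy hz _; apply: addB.
have evec1 (i : 'I_d) : inbox 1 (evec i : 'rV[R]_d).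
  by rewrite -[evec i]scale1r; apply: inbox_evec; rewrite normr1.
(* For an exact quadratic form [B] is four times its bilinear form. *)
exists (\matrix_(i, j) (B (evec i) (evec j) / 4)).
  by apply/matrixP => i j; rewrite !mxE BC.
move=> x hx.
set c := (4 * d.+1)%:R * (4 * e) in linB.
have sum_le : `|\sum_i x ord0 i * B (evec i) x
    - \sum_i x ord0 i * \sum_j x ord0 j * B (evec j) (evec i)| <= d%:R * c.
  rewrite -sumrB; apply: (le_trans (ler_norm_sum _ _ _)).
  rewrite mulr_natl -[X in _ *+ X]card_ord -sumr_const; apply: ler_sum => i _.
  rewrite -mulrBr normrM -[c]mul1r ler_pM //; first by move/inboxP: hx.
  by rewrite BC; apply: linB.
have formE : (x *m (\matrix_(i, j) (B (evec i) (evec j) / 4)) *m x^T) ord0 ord0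
    = (\sum_i x ord0 i * \sum_j x ord0 j * B (evec j) (evec i)) / 4.
  rewrite mxE mulr_suml; apply: eq_bigr => i _.
  rewrite !mxE -mulrA [RHS]mulrC; congr (_ * _).
  by rewrite mulr_suml; apply: eq_bigr => j _; rewrite mxE mulrA.
rewrite formE.
have := sum_le; have := linB _ _ hx hx.
have x4 := @box4 1 _ isT hx.
(* The law at [x, x] compares [q (x + x)], which is [B x x + q 0], with [4 * q x]; the law at [0, 0]
   bounds [q 0]. *)
have := qD x x x4 x4 (@box4 2 _ isT (inboxD hx hx)); rewrite subrr => /(_ (inbox0 _ (ler0n _ 4))).
have := qD 0 0 (inbox0 _ (ler0n _ 4)) (inbox0 _ (ler0n _ 4)).
rewrite subr0 addr0 => /(_ (inbox0 _ (ler0n _ 4)) (inbox0 _ (ler0n _ 4))).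
rewrite {1}/B subrr.
set S1 := \sum_i _; set S2 := \sum_i _.
have -> : (5 * d.+1 ^ 2)%:R * e = (5 * (d%:R + 1) ^+ 2) * e :> R.
  by rewrite natrM natrX -[d.+1%:R]natr1.
have -> : c = 16 * (d%:R + 1) * e by rewrite /c natrM -[d.+1%:R]natr1; ring.
have h0 : 0 <= d%:R * e :> R by rewrite mulr_ge0 // ler0n.
have h1 : 0 <= d%:R ^+ 2 * e :> R by rewrite mulr_ge0 // sqr_ge0.
clear -e0 h0 h1.
move: (q (x + x)) (q x) (q 0) S1 S2 => qxx qx q0 S1 S2.
rewrite !ler_norml => /andP[? ?] /andP[? ?] /andP[? ?] /andP[? ?].
apply/andP; split; nra.
Qed.

Lemma dotvDl (R : realType) (d : nat) (x y m : 'rV[R]_d) :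
  dotv (x + y) m = dotv x m + dotv y m.
Proof. by rewrite /dotv -big_split; apply: eq_bigr => i _; rewrite mxE mulrDl. Qed.

Lemma dotvZl (R : realType) (d : nat) (c : R) (x m : 'rV[R]_d) :
  dotv (c *: x) m = c * dotv x m.
Proof. by rewrite /dotv mulr_sumr; apply: eq_bigr => i _; rewrite mxE mulrA. Qed.

Lemma dotvC (R : realType) (d : nat) (x m : 'rV[R]_d) : dotv x m = dotv m x.
Proof. by apply: eq_bigr => i _; rewrite mulrC. Qed.

Lemma dotvDr (R : realType) (d : nat) (m x y : 'rV[R]_d) :
  dotv m (x + y) = dotv m x + dotv m y.
Proof. by rewrite !(dotvC m) dotvDl. Qed.

Lemma dotvZr (R : realType) (d : nat) (c : R) (m x : 'rV[R]_d) :
  dotv m (c *: x) = c * dotv m x.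
Proof. by rewrite !(dotvC m) dotvZl. Qed.

Lemma dotvNl (R : realType) (d : nat) (x m : 'rV[R]_d) : dotv (- x) m = - dotv x m.
Proof. by rewrite -scaleN1r dotvZl mulN1r. Qed.

Lemma dotvNr (R : realType) (d : nat) (x m : 'rV[R]_d) : dotv x (- m) = - dotv x m.
Proof. by rewrite dotvC dotvNl dotvC. Qed.

(** Near [1] the phase has a small single-valued logarithm [th], which is almost additive. The [16]
    is the [4] of the additive case times a [2] for each passage between angles and the circle. *)
Lemma approx_character_near1 (R : realType) (d : nat) (phi : 'rV[R]_d -> R[i]) (e : R) :
  (forall x, inbox 1 x -> normc (phi x) = 1) ->
  (forall x, inbox 1 x -> normc (phi x - 1) <= 1 / 8) ->
  (forall x y, inbox 1 x -> inbox 1 y -> inbox 1 (x + y) ->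
    normc (phi (x + y) - phi x * phi y) <= e) ->
  exists m : 'rV[R]_d, forall x, inbox 1 x ->
    normc (phi x - expi (dotv x m)) <= (16 * d.+1)%:R * e.
Proof.
move=> phi1 phin phiM.
have angle x : exists t, inbox 1 x -> phi x = expi t /\ `|t| <= 1 / 4.
  case: (boolP (inbox 1 x)) => hx; last by exists 0.
  by have [t ? ?] := exists_angle (phi1 _ hx) (phin _ hx); exists t.
have [th hth] := choice angle.
have thD x y : inbox 1 x -> inbox 1 y -> inbox 1 (x + y) ->
    `|th (x + y) - th x - th y| <= 2 * e.
  move=> hx hy hxy; have [ex tx] := hth _ hx; have [ey ty] := hth _ hy.
  have [exy txy] := hth _ hxy.
  apply: expi_near1.
    by move: tx ty txy; rewrite !ler_norml => /andP[? ?] /andP[? ?] /andP[? ?]; lra.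
  apply: le_trans (phiM _ _ hx hy hxy).
  rewrite ex ey exy -expiD.
  have -> : expi (th (x + y)) - expi (th x + th y)
    = expi (th x + th y) * (expi (th (x + y) - th x - th y) - 1).
    by rewrite mulrBr mulr1 -expiD; congr (expi _ - _); ring.
  by rewrite normcM normc_expi mul1r.
exists (\row_i th (evec i)) => x hx.
have := @approx_additive_box R d th _ _ (fun x hx => (hth x hx).2) thD x hx.
rewrite (hth _ hx).1; set s := \sum_i _ => hs.
have -> : dotv x (\row_i th (evec i)) = s by apply: eq_bigr => i _; rewrite mxE.
apply: (le_trans (normc_expi_dist _ _)).
have -> : (16 * d.+1)%:R * e = 2 * ((4 * d.+1)%:R * (2 * e)) by rewrite !natrM; ring.
by rewrite ler_pM2l ?ltr0n.
Qed.

(* The linear phase may wind many times over the box, so it is fitted first near the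
   origin and then refitted each time the scale is doubled; refitting keeps the error
   from accumulating. *)
Lemma approx_character_box (R : realType) (d : nat) (phi : 'rV[R]_d -> R[i]) (e r : R) :
  (forall x, inbox 1 x -> normc (phi x) = 1) ->
  0 < r -> (forall x, inbox r x -> normc (phi x - 1) <= 1 / 8) ->
  (forall x y, inbox 1 x -> inbox 1 y -> inbox 1 (x + y) ->
    normc (phi (x + y) - phi x * phi y) <= e) ->
  (33 * d.+1)%:R * e <= 1 / 8 ->
  exists m : 'rV[R]_d, forall x, inbox 1 x ->
    normc (phi x - expi (dotv x m)) <= (16 * d.+1)%:R * e.
Proof.
move=> phi1 r0 phir phiM e_small.
set C := (16 * d.+1)%:R.
have e0 : 0 <= e.
  have h0 : inbox 1 (0 : 'rV[R]_d) := inbox0 _ ler01.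
  by have := phiM 0 0 h0 h0; rewrite addr0 => /(_ h0); apply: le_trans; apply: normc_ge0.
have p0 n : 0 < (2 ^+ n)^-1 :> R by rewrite invr_gt0 exprn_gt0.
have p1 n : (2 ^+ n)^-1 <= 1 :> R by rewrite invf_le1 ?exprn_gt0 // exprn_ege1 ?ler1n.
(* Dividing by the current linear phase brings [phi] close to [1], where a logarithm exists;
   rescaling makes the small box the unit box. *)
have refit n m : (forall x, inbox (2 ^+ n)^-1 x ->
      normc (phi x * expi (- dotv x m) - 1) <= 1 / 8) ->
    exists m' : 'rV[R]_d, forall x, inbox (2 ^+ n)^-1 x ->
      normc (phi x - expi (dotv x m')) <= C * e.
  move=> hm.
  pose psi x := phi ((2 ^+ n)^-1 *: x) * expi (- dotv ((2 ^+ n)^-1 *: x) m).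
  have scl (x : 'rV[R]_d) : inbox 1 x -> inbox (2 ^+ n)^-1 ((2 ^+ n)^-1 *: x).
    by move=> /(inboxZ (2 ^+ n)^-1); rewrite mulr1 gtr0_norm.
  have scl1 (x : 'rV[R]_d) : inbox 1 x -> inbox 1 ((2 ^+ n)^-1 *: x).
    by move=> hx; exact: (inboxW (p1 n) (scl x hx)).
  have [||x y hx hy hxy|m' hm'] := @approx_character_near1 R d psi e.
  - by move=> x hx; rewrite normcM normc_expi phi1 ?mul1r // scl1.
  - by move=> x hx; apply: hm; apply: scl.
  - rewrite /psi scalerDr dotvDl opprD expiD.
    set a := phi (_ + _); set b := phi _; set c := phi _; set u := expi _; set v := expi _.
    have -> : a * (u * v) - b * u * (c * v) = (a - b * c) * (u * v) by ring.
    rewrite !normcM !normc_expi !mulr1; apply: phiM; rewrite -?scalerDr; exact: scl1.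
  exists (2 ^+ n *: m' + m) => x hx.
  have e2 : (2 ^+ n)^-1 *: (2 ^+ n *: x) = x.
    by rewrite scalerA mulVf ?scale1r // expf_neq0.
  have hx' : inbox 1 (2 ^+ n *: x).
    have := inboxZ (2 ^+ n) hx.
    by rewrite ger0_norm ?exprn_ge0 // divff // expf_neq0.
  have := hm' _ hx'; rewrite /psi e2 dotvZl dotvDr dotvZr expiD.
  set a := expi (2 ^+ n * _); set b := expi (- _) => h.
  have -> : phi x - a * expi (dotv x m) = expi (dotv x m) * (phi x * b - a).
    have hb : expi (dotv x m) * b = 1 by rewrite -expiD subrr expi0.
    by rewrite mulrBr mulrCA hb mulr1 [a * _]mulrC.
  by rewrite normcM normc_expi mul1r.
(* On the doubled box the error is at most twice the old one plus [e], thus below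
   [(33 * d.+1)%:R * e <= 1 / 8], and a refit is possible. *)
have fit n : (exists m' : 'rV[R]_d, forall x, inbox (2 ^+ n)^-1 x ->
      normc (phi x - expi (dotv x m')) <= C * e) ->
    exists m' : 'rV[R]_d, forall x, inbox 1 x ->
      normc (phi x - expi (dotv x m')) <= C * e.
  elim: n => [|n IH]; first by rewrite expr0 invr1.
  move=> [m hm]; apply: IH; apply: (refit n m) => x hx.
  pose y := 2^-1 *: x.
  have yy : x = y + y by apply/rowP => i; rewrite !mxE; field.
  have hy : inbox (2 ^+ n.+1)^-1 y.
    have := inboxZ 2^-1 hx; rewrite exprS invfM.
    by rewrite ger0_norm ?invr_ge0.
  have hy1 := inboxW (p1 _) hy.
  have hyy : inbox 1 (y + y) by rewrite -yy; apply: inboxW (p1 n) hx.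
  have h1 := phiM _ _ hy1 hy1 hyy; have h2 := hm _ hy.
  rewrite yy dotvDl opprD expiD.
  set u := expi (- _).
  have u1 : normc u = 1 by rewrite normc_expi.
  have uv : expi (dotv y m) * u = 1 by rewrite -expiD subrr expi0.
  have -> : phi (y + y) * (u * u) - 1 =
     (phi (y + y) - phi y * phi y) * (u * u)
     + (phi y * phi y - expi (dotv y m) * expi (dotv y m)) * (u * u).
    have : expi (dotv y m) * expi (dotv y m) * (u * u) = 1.
      by rewrite mulrACA uv mulr1.
    by move=> h; rewrite !mulrBl h; ring.
  apply: (le_trans (le_normcD _ _)); rewrite !normcM !u1 !mulr1.
  have h3 : normc (phi y * phi y - expi (dotv y m) * expi (dotv y m)) <= C * e + C * e.
    by apply: normcM_dist_le1; rewrite ?phi1 ?normc_expi.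
  apply: (le_trans (lerD h1 h3)); apply: le_trans e_small.
  rewrite /C !natrM; have : 0 <= d%:R * e by rewrite mulr_ge0.
  rewrite -natr1; nra.
have [n hn] := exists_exp2_gt r^-1.
apply: (fit n); apply: (refit n 0) => x hx.
rewrite [dotv x 0]big1 ?oppr0 ?expi0 ?mulr1; last by move=> i _; rewrite mxE mulr0.
apply: phir; apply: inboxW hx.
by rewrite invf_ple ?posrE ?exprn_gt0 // ltW.
Qed.

(** * Gaussian approximation on a box *)

Definition qform {R : realType} {d : nat} (A : 'M[R]_d) (t : 'rV[R]_d) : R :=
  (t *m A *m t^T) ord0 ord0.

Lemma qformZ (R : realType) (d : nat) (A : 'M[R]_d) (c : R) (t : 'rV[R]_d) :
  qform A (c *: t) = c ^+ 2 * qform A t.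
Proof. by rewrite /qform -!scalemxAl linearZ -scalemxAr !mxE expr2 mulrA. Qed.

(* [h] satisfies up to [e] the equation characterising exponentials of quadratic forms. *)
Definition approx_exp_form {R : realType} {d : nat} (h : 'rV[R]_d -> R) (e : R) : Prop :=
  [/\ h 0 = 1, (forall t, 0 <= h t <= 1), (forall t, h (- t) = h t)
    & forall s t, `|h (s + t) * h (s - t) - h s ^+ 2 * h t ^+ 2| <= e].

(** For a Hermitian [F] the factor [h t ^+ 2] is [F t * F (- t)]. A Gaussian characteristic function
    and its modulus solve the equation exactly. *)
Definition approx_gauss_cf {R : realType} {d : nat} (F : 'rV[R]_d -> R[i])
    (h : 'rV[R]_d -> R) (e : R) : Prop :=
  [/\ F 0 = 1, (forall t, normc (F t) = h t)
    & forall s t, normc (F (s + t) * F (s - t) - F s ^+ 2 * (h t ^+ 2)%:C) <= e].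

Lemma ln_lipschitz (R : realType) (a b c : R) : 0 < c -> c <= a -> c <= b ->
  `|ln a - ln b| <= `|a - b| / c.
Proof.
move=> c0; wlog ab : a b / b <= a => [H ca cb|ca cb].
  case: (leP b a) => [/H|/ltW/H]; first by apply.
  by rewrite distrC (distrC a); apply.
have b0 : 0 < b := lt_le_trans c0 cb.
have a0 : 0 < a := lt_le_trans c0 ca.
rewrite ger0_norm ?subr_ge0 ?ler_ln ?posrE // ger0_norm ?subr_ge0 //.
rewrite -ln_div ?posrE //; have -> : a / b = 1 + (a - b) / b by field; rewrite gt_eqF.
apply: (le_trans (le_ln1Dx _)); last first.
  by rewrite ler_wpM2l ?subr_ge0 // lef_pV2.
by apply: (lt_le_trans (ltrN10 _)); rewrite divr_ge0 ?subr_ge0 ?(ltW b0).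
Qed.

Lemma expR_near1 (R : realType) (u : R) : `|u| <= 1 / 2 -> `|expR u - 1| <= 2 * `|u|.
Proof.
move=> hu; have h1 := expR_ge1Dx u; have h2 := expR_ge1Dx (- u).
have h3 := expRxMexpNx_1 u; have h4 := expR_gt0 u.
move: hu; rewrite ler_norml => /andP[u1 u2].
have h5 : expR u * (1 - u) <= 1 by rewrite -[leRHS]h3 ler_pM2l.
have [u0|u0] := ger0P u; rewrite ler_norml.
  have u3 : 0 < 1 - u by lra.
  apply/andP; split; first by lra.
  rewrite -(ler_pM2r u3) mulrBl mul1r.
  have : 0 <= u * (1 / 2 - u) by rewrite mulr_ge0 //; lra.
  lra.
have : expR u * u <= 0 by rewrite pmulr_rle0 // ltW.
by move=> ?; apply/andP; split; lra.
Qed.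

(** On the large box both sides of the equation are at least [1 / 16], so logarithms cost a factor
    [16]; [160] is [5 * 16] times [2] for the return through the exponential. *)
Lemma approx_exp_form_box (R : realType) (d : nat) (h : 'rV[R]_d -> R) (e : R) :
  approx_exp_form h e -> (forall x, inbox 4 x -> 1 / 2 <= h x) ->
  (160 * d.+1 ^ 2)%:R * e <= 1 ->
  exists2 A : 'M[R]_d, A^T = A & forall x, inbox 1 x ->
    `|h x - expR (- qform A x)| <= (160 * d.+1 ^ 2)%:R * e.
Proof.
move=> [h0 h01 hN hfe] hbox e_small.
have hp x : inbox 4 x -> 0 < h x by move=> /hbox; lra.
have [|x|s t hs ht hst hsBt|A AT hA] :=
    @approx_quadratic_box R d (fun x => - ln (h x)) (16 * e) (`|1 - 2^-1| / 2^-1).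
- move=> x hx; rewrite normrN -[ln _]subr0 -ln1.
  apply: (le_trans (@ln_lipschitz R (h x) 1 2^-1 _ _ _)); try lra.
    by have := hbox _ hx; lra.
  rewrite ler_pM2r ?invr_gt0 // distrC !ger0_norm; try lra.
    by have := hbox _ hx; lra.
  by have := h01 x; lra.
- by rewrite hN.
- have [ps pt] := (hp _ hs, hp _ ht); have [pst psBt] := (hp _ hst, hp _ hsBt).
  have -> : - ln (h (s + t)) + - ln (h (s - t)) - 2 * - ln (h s) - 2 * - ln (h t)
     = ln (h s ^+ 2 * h t ^+ 2) - ln (h (s + t) * h (s - t)).
    by rewrite !lnM ?posrE ?mulr_gt0 //; ring.
  have [hs2 ht2] := (hbox _ hs, hbox _ ht); have [hst2 hsBt2] := (hbox _ hst, hbox _ hsBt).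
  have [hs3 ht3] : 1 / 4 <= h s ^+ 2 /\ 1 / 4 <= h t ^+ 2 by split; nra.
  apply: (le_trans (@ln_lipschitz R _ _ (1 / 16) _ _ _)); try nra.
  rewrite distrC; have := hfe s t; lra.
exists A => // x hx.
have := hA _ hx; rewrite -/(qform A x).
set a := qform A x => ha.
have hx0 : 0 < h x by apply: hp; apply: inboxW hx; lra.
have ex : (5 * d.+1 ^ 2)%:R * (16 * e) = (80 * d.+1 ^ 2)%:R * e by rewrite !natrM; ring.
have ex2 : (160 * d.+1 ^ 2)%:R * e = 2 * ((80 * d.+1 ^ 2)%:R * e) by rewrite !natrM; ring.
rewrite ex in ha; rewrite ex2 in e_small *.
set c := _ * e in ha e_small *.
have -> : h x - expR (- a) = - (h x * (expR (- ln (h x) - a) - 1)).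
  rewrite mulrBr mulr1 opprB expRD (expRN (ln _)) lnK ?posrE // mulrA divff ?mul1r //.
  by rewrite gt_eqF.
rewrite normrN normrM (gtr0_norm hx0).
have hu : `|- ln (h x) - a| <= 1 / 2 by lra.
have /andP[_ hx1] := h01 x.
apply: (le_trans (ler_pM (ltW hx0) (normr_ge0 _) hx1 (expR_near1 hu))).
lra.
Qed.

(** For [phi = F / h], both [phi x * phi y] and [phi (x + y) * phi 0] are close to the square of
    [phi] at the midpoint, so [phi] is almost a character. Dividing by
    [h s ^+ 2 * h t ^+ 2 >= 1 / 16] turns [2 * e] into [32 * e], and two such errors give [64 * e].
    The radius [r] enters no constant. *)
Lemma approx_gauss_cf_phase_box (R : realType) (d : nat) (F : 'rV[R]_d -> R[i])
    (h : 'rV[R]_d -> R) (e r : R) :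
  approx_exp_form h e -> approx_gauss_cf F h e ->
  (forall x, inbox 4 x -> 1 / 2 <= h x) ->
  0 < r -> (forall x, inbox r x -> normc (F x - 1) <= 1 / 16) ->
  (33 * d.+1)%:R * (64 * e) <= 1 / 8 ->
  exists m : 'rV[R]_d, forall x, inbox 1 x ->
    normc (F x - (h x)%:C * expi (dotv x m)) <= (1024 * d.+1)%:R * e.
Proof.
move=> [h0 h01 hN hfe] [F0 Fh Ffe] hbox r0 Fr e_small.
have hp x : inbox 4 x -> 0 < h x by move=> /hbox; lra.
have box1 (x : 'rV[R]_d) : inbox 1 x -> inbox 4 x by apply: inboxW; lra.
pose phi x := F x * (h x)^-1%:C.
have Fphi x : inbox 4 x -> F x = (h x)%:C * phi x.
  move=> hx; rewrite /phi mulrCA -rmorphM divff ?mulr1 //.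
  by rewrite gt_eqF // hp.
have phi1 x : inbox 4 x -> normc (phi x) = 1.
  move=> /hp hx; rewrite /phi normcM normc_real Fh gtr0_norm ?invr_gt0 //.
  by rewrite divff // gt_eqF.
have phi0 : phi 0 = 1 by rewrite /phi F0 h0 invr1 mul1r.
have jensen s t : inbox 4 s -> inbox 4 t -> inbox 4 (s + t) -> inbox 4 (s - t) ->
    normc (phi (s + t) * phi (s - t) - phi s ^+ 2) <= 32 * e.
  move=> hs ht hst hsBt.
  have [ps pt] := (hp _ hs, hp _ ht); have [pst psBt] := (hp _ hst, hp _ hsBt).
  have [hs2 ht2] := (hbox _ hs, hbox _ ht); have [hst2 hsBt2] := (hbox _ hst, hbox _ hsBt).
  have [hs3 ht3] : 1 / 4 <= h s ^+ 2 /\ 1 / 4 <= h t ^+ 2 by split; nra.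
  pose P := phi (s + t) * phi (s - t).
  have P1 : normc P = 1 by rewrite normcM !phi1 ?mul1r.
  have Pe : F (s + t) * F (s - t) = P * (h (s + t) * h (s - t))%:C.
    by rewrite !Fphi // rmorphM /P; ring.
  have Qe : F s ^+ 2 * (h t ^+ 2)%:C = phi s ^+ 2 * (h s ^+ 2 * h t ^+ 2)%:C.
    by rewrite Fphi // exprMn !rmorphM; ring.
  have q0 : 0 < h s ^+ 2 * h t ^+ 2 by rewrite mulr_gt0 ?exprn_gt0.
  have := Ffe s t; have := hfe s t; rewrite Pe Qe.
  have : 1 / 16 <= h s ^+ 2 * h t ^+ 2 by nra.
  move: q0; set q := h s ^+ 2 * _; set p := h (s + t) * _ => q0 q16 hpq hPQ.
  have : normc ((P - phi s ^+ 2) * q%:C) <= 2 * e.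
    have -> : (P - phi s ^+ 2) * q%:C = P * (q - p)%:C + (P * p%:C - phi s ^+ 2 * q%:C).
      by rewrite rmorphB; ring.
    apply: (le_trans (le_normcD _ _)); rewrite normcM P1 mul1r normc_real distrC; lra.
  rewrite normcM normc_real (gtr0_norm q0).
  have := normc_ge0 (P - phi s ^+ 2); nra.
have phiM x y : inbox 1 x -> inbox 1 y -> inbox 1 (x + y) ->
    normc (phi (x + y) - phi x * phi y) <= 64 * e.
  move=> hx hy hxy.
  pose s := 2^-1 *: (x + y); pose s' := 2^-1 *: (x - y).
  have h2 : `|2^-1 : R| * (1 + 1) = 1.
    by rewrite ger0_norm ?invr_ge0 ?ler0n // mulVf // pnatr_eq0.
  have hs : inbox 4 s by apply: box1; have := inboxZ 2^-1 (inboxD hx hy); rewrite h2.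
  have hs' : inbox 4 s'.
    apply: box1.
    by have := inboxZ 2^-1 (inboxD hx (_ : inbox 1 (- y))); rewrite h2 inboxN => /(_ hy).
  have ss' : s + s' = x.
    by apply/rowP => i; rewrite !mxE; field.
  have sBs' : s - s' = y.
    by apply/rowP => i; rewrite !mxE; field.
  have ss : s + s = x + y.
    by apply/rowP => i; rewrite !mxE; field.
  have := jensen _ _ hs hs'; rewrite ss' sBs' => /(_ (box1 _ hx) (box1 _ hy)) j1.
  have := jensen _ _ hs hs; rewrite ss subrr phi0 mulr1.
  move=> /(_ (box1 _ hxy) (inbox0 _ (ler0n _ 4))) j2.
  apply: (le_trans (normc_dist (phi s ^+ 2) _ _)); rewrite (normc_sub (_ ^+ 2)); lra.
have [||x hx|||m hm] := @approx_character_box R d phi (64 * e) (Num.min r 1).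
- by move=> x /box1; apply: phi1.
- by rewrite lt_min r0 ltr01.
- have hx4 : inbox 4 x by apply: inboxW hx; rewrite ge_min; apply/orP; right; lra.
  have hxr : inbox r x by apply: inboxW hx; rewrite ge_min lexx.
  have F1 := Fr _ hxr.
  (* As [h] is the modulus of [F], also [1 - h x <= 1 / 16]; the two errors add up to [1 / 8]. *)
  apply: (le_trans (normc_dist (F x) _ _)).
  have -> : phi x - F x = phi x * (1 - h x)%:C.
    by rewrite rmorphB mulrBr mulr1 [in LHS]Fphi // mulrC.
  rewrite normcM phi1 // mul1r normc_real.
  have := ler_normc_dist (F x) 1; rewrite Fh normc1 distrC; lra.
- exact: phiM.
- exact: e_small.
exists m => x hx; have hx4 := box1 _ hx.
rewrite Fphi // -mulrBr normcM normc_real (gtr0_norm (hp _ hx4)).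
have -> : (1024 * d.+1)%:R * e = 1 * ((16 * d.+1)%:R * (64 * e)) by rewrite !natrM; ring.
have /andP[hx0 hx1] := h01 x.
by apply: ler_pM => //; [exact: normc_ge0 | exact: hm].
Qed.

(** * Extension to the whole space *)

(** Normalised without the [1 / 2] of [gauss_cf], because [A] is fitted to [- ln h] itself. *)
Definition gaussE {R : realType} {d : nat} (A : 'M[R]_d) (m t : 'rV[R]_d) : R[i] :=
  (expR (- qform A t))%:C * expi (dotv t m).

Lemma normc_gaussE (R : realType) (d : nat) (A : 'M[R]_d) (m t : 'rV[R]_d) :
  normc (gaussE A m t) = expR (- qform A t).
Proof. by rewrite normcM normc_expi mulr1 normc_real gtr0_norm // expR_gt0. Qed.

Lemma gaussE_double (R : realType) (d : nat) (A : 'M[R]_d) (m t : 'rV[R]_d) :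
  gaussE A m (2 *: t) = gaussE A m t ^+ 2 * (expR (- qform A t) ^+ 2)%:C.
Proof.
rewrite /gaussE qformZ dotvZl.
have -> : - (2 ^+ 2 * qform A t) = 4%:R * - qform A t by ring.
have -> : 2 * dotv t m = dotv t m + dotv t m by ring.
by rewrite expRM_natl expiD rmorphXn (exprD _ 2 2) !rmorphM /=; ring.
Qed.

(** Bernoulli's inequality applied to [h (2 y) >= h y ^+ 4 - e]. Read backwards, it tells how far
    below [1] the value [h x] lies when [h] is small at [2 ^+ n *: x]. The two terms in [e] close
    the induction. *)
Lemma approx_exp_form_grow (R : realType) (d : nat) (h : 'rV[R]_d -> R) (e : R)
    (x : 'rV[R]_d) n :
  approx_exp_form h e -> 1 - h (2 ^+ n *: x) <= 4 ^+ n * (1 - h x + e) - e.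
Proof.
move=> [h0 h01 _ hfe].
elim: n => [|n IH]; first by rewrite !expr0 scale1r mul1r addrK.
set y := 2 ^+ n *: x in IH.
have yy : 2 ^+ n.+1 *: x = y + y.
  by rewrite exprS -scalerA scaler_nat mulr2n.
have := hfe y y; rewrite subrr h0 mulr1 -yy -exprD ler_norml => /andP[h1 _].
have /andP[y0 y1] := h01 y.
have : 1 - 4 * (1 - h y) <= h y ^+ (2 + 2).
  rewrite -subr_ge0.
  have -> : h y ^+ (2 + 2) - (1 - 4 * (1 - h y))
    = (1 - h y) ^+ 2 * (h y ^+ 2 + 2 * h y + 3) by ring.
  by rewrite mulr_ge0 ?sqr_ge0 // !addr_ge0 ?sqr_ge0 // mulr_ge0.
have e0 : 0 <= e by apply: le_trans (hfe 0 0); apply: normr_ge0.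
have -> : 4 ^+ n.+1 * (1 - h x + e) - e = 4 * (4 ^+ n * (1 - h x + e) - e) + 3 * e.
  by rewrite exprS; ring.
lra.
Qed.

Lemma inbox_scale_pow (R : realType) (d : nat) (t : 'rV[R]_d) :
  ~~ inbox 1 t -> exists n (x : 'rV[R]_d),
    [/\ t = 2 ^+ n *: x, inbox 1 x & ~~ inbox (1 / 2) x].
Proof.
move=> ht.
have p0 n : (2 ^+ n != 0 :> R) by rewrite expf_neq0.
have ex : exists n, inbox 1 ((2 ^+ n)^-1 *: t).
  have [n hn] := exists_exp2_gt (\sum_i `|t ord0 i|).
  exists n; apply/inboxP => i; rewrite mxE normrM gtr0_norm ?invr_gt0 ?exprn_gt0 //.
  rewrite mulrC ler_pdivrMr ?exprn_gt0 // mul1r; apply: le_trans (ltW hn).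
  by rewrite (bigD1 i) //= lerDl sumr_ge0.
have nS n : (2 ^+ n)^-1 *: t = 2 *: ((2 ^+ n.+1)^-1 *: t).
  by rewrite scalerA exprS invfM mulVKf.
case: (ex_minnP ex) => -[|n] hn hmin.
  by move: hn; rewrite expr0 invr1 scale1r (negbTE ht).
exists n.+1, ((2 ^+ n.+1)^-1 *: t); split => //.
  by rewrite scalerA divff ?scale1r.
apply/negP => /(inboxZ 2); rewrite -nS ger0_norm // => h.
have : inbox 1 ((2 ^+ n)^-1 *: t) by apply: inboxW h; lra.
by move/hmin; rewrite ltnn.
Qed.

Lemma qform_ge0_outside (R : realType) (d : nat) (A : 'M[R]_d) :
  (forall t, ~~ inbox 1 t -> 0 <= qform A t) -> forall t, 0 <= qform A t.
Proof.
move=> hA t; have [->|/eqP t0] := eqVneq t 0; first by rewrite /qform !mul0mx mxE.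
have [i ti] : exists i, t ord0 i != 0.
  apply: contrapT => H; apply: t0; apply/rowP => i; rewrite mxE.
  by apply/eqP/negPn/negP => ti; apply: H; exists i.
have [n hn] := exists_exp2_gt (`|t ord0 i|^-1).
have : 0 <= qform A (2 ^+ n *: t).
  apply: hA; apply/negP => /inboxP/(_ i); apply/negP; rewrite -ltNge mxE normrM.
  rewrite ger0_norm ?exprn_ge0 // -ltr_pdivrMr ?normr_gt0 // mul1r.
  exact: hn.
by rewrite qformZ pmulr_rge0 // !exprn_gt0.
Qed.

(** The first [J.+2] doublings may multiply the error by four each, which yields the factor
    [4 ^+ J.+2]. After them the form is at least [1], [h] and the Gaussian are both small, and
    doubling contracts the error. *)
Lemma approx_gauss_cf_extend (R : realType) (d : nat) (F : 'rV[R]_d -> R[i])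
    (h : 'rV[R]_d -> R) (e C1 : R) (J : nat) (A : 'M[R]_d) (m : 'rV[R]_d) :
  approx_exp_form h e -> approx_gauss_cf F h e -> 0 <= C1 ->
  (forall x, inbox 1 x -> normc (F x - gaussE A m x) <= C1 * e) ->
  (forall t, ~~ inbox (2 ^+ J) t -> exists2 l : R, 0 <= l <= 1 & h (l *: t) < 1 / 2) ->
  (C1 + 1) * 4 ^+ J.+2 * e <= 1 / 16 ->
  (forall t, 0 <= qform A t) /\
  (forall t, normc (F t - gaussE A m t) <= (C1 + 1) * 4 ^+ J.+2 * e).
Proof.
move=> hh [F0 Fh Ffe] C10 FE hexit e_small.
have [h0 h01 hN hfe] := hh.
set D := (C1 + 1) * 4 ^+ J.+2 in e_small *.
have e0 : 0 <= e by apply: le_trans (hfe 0 0); apply: normr_ge0.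
have K0 : 1 <= (4 : R) ^+ J.+2 by rewrite exprn_ege1 // ler1n.
have D4 : 4 <= D.
  rewrite /D exprS; have : 1 <= (4 : R) ^+ J.+1 by rewrite exprn_ege1 // ler1n.
  nra.
have C1D : C1 * e <= D * e by rewrite ler_wpM2r // /D; nra.
have hG x : `|h x - expR (- qform A x)| <= normc (F x - gaussE A m x).
  by rewrite -Fh -(normc_gaussE A m) ler_normc_dist.
(* Some point of the segment to [2 ^+ J.+1 *: t] has [h < 1 / 2]. The growth bound carries this back
   to the unit box, where [h] is close to [expR (- qform A x) >= 1 - qform A x]. *)
have shell t : inbox 1 t -> ~~ inbox (1 / 2) t -> 1 <= qform A (2 ^+ J.+2 *: t).
  move=> t1 t2.
  have [|l /andP[l0 l1] hl] := hexit (2 ^+ J.+1 *: t).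
    apply/negP => /(inboxZ (2 ^+ J.+1)^-1).
    rewrite scalerA mulVf ?expf_neq0 // scale1r gtr0_norm ?invr_gt0 ?exprn_gt0 //.
    by rewrite exprS invfM -mulrA mulVf ?expf_neq0 // -div1r mulr1 (negbTE t2).
  set x := l *: t.
  have {}hl : h (2 ^+ J.+1 *: x) < 1 / 2 by rewrite /x scalerA mulrC -scalerA.
  have x1 : inbox 1 x.
    by have := inboxZ l t1; rewrite mulr1 ger0_norm //; apply: inboxW.
  have := approx_exp_form_grow x J.+1 hh; have := hG x; have := FE _ x1.
  rewrite ler_norml => g1 /andP[g2 g3] g4.
  have := expR_ge1Dx (- qform A x); rewrite (qformZ A l t : qform A x = _) in g2 g3 * => g5.
  have ka : 1 <= l ^+ 2 * (4 ^+ J.+2 * qform A t).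
    rewrite (exprS _ J.+1) -[_ * qform A t]mulrA.
    have e4 : (C1 + 1) * e * (4 * 4 ^+ J.+1) <= 1 / 16.
      by rewrite -exprS mulrAC.
    set k := 4 ^+ J.+1 in g4 e4 *.
    have k1 : 1 <= k by rewrite exprn_ege1 // ler1n.
    have hk : 1 / 2 < k * (l ^+ 2 * qform A t + C1 * e + e).
      apply: (lt_le_trans (y := k * (1 - h x + e))).
        have : 1 / 2 < 1 - h (2 ^+ J.+1 *: x) by lra.
        lra.
      rewrite ler_pM2l; lra.
    have -> : l ^+ 2 * (4 * (k * qform A t)) = 4 * (k * (l ^+ 2 * qform A t + C1 * e + e))
       - (C1 + 1) * e * (4 * k) by ring.
    lra.
  rewrite qformZ -exprM mulnC exprM.
  have -> : (2 : R) ^+ 2 = 4 by ring.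
  set w := 4 ^+ J.+2 * qform A t in ka *.
  have l2 : l ^+ 2 <= 1 by rewrite expr_le1.
  have l20 : 0 <= l ^+ 2 := sqr_ge0 _.
  have [w0|w0] := lerP 0 w.
    by apply: (le_trans ka); rewrite ler_piMl.
  have : l ^+ 2 * w <= 0 by rewrite mulr_ge0_le0 // ltW.
  lra.
have A0 : forall t, 0 <= qform A t.
  apply: qform_ge0_outside => t /inbox_scale_pow[n [x [-> x1 x2]]].
  rewrite qformZ mulr_ge0 ?exprn_ge0 //.
  by have := shell _ x1 x2; rewrite qformZ => h1; rewrite -(pmulr_rge0 (x := (2 ^+ J.+2) ^+ 2)) ?exprn_gt0 //; lra.
split => // t.
have [t1|/inbox_scale_pow[n [x [-> x1 x2]]]] := boolP (inbox 1 t).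
  by apply: (le_trans (FE _ t1)).
pose dist y := normc (F y - gaussE A m y).
pose G y := expR (- qform A y).
have G1 y : 0 < G y <= 1 by rewrite expR_gt0 expR_le1 oppr_le0 A0.
(* The factor is that of a difference of fourth powers: at most [4], and below [1] once both moduli
   are near [1 / 2]. *)
have double y : dist (2 *: y) <=
    e + dist y * ((h y + G y) * (h y ^+ 2 + G y ^+ 2)).
  have := Ffe y y; rewrite subrr F0 mulr1 -mulr2n -scaler_nat => h1.
  apply: (le_trans (normc_dist (F y ^+ 2 * (h y ^+ 2)%:C) _ _)).
  apply: lerD => //; rewrite gaussE_double -/(G y).
  have /andP[y0 y1] := h01 y; have /andP[g0 g1] := G1 y.
  set E := gaussE A m y.
  have -> : F y ^+ 2 * (h y ^+ 2)%:C - E ^+ 2 * (G y ^+ 2)%:C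
     = (F y - E) * ((F y + E) * (h y ^+ 2)%:C) + E ^+ 2 * ((h y - G y) * (h y + G y))%:C.
    rewrite (_ : (h y - G y) * (h y + G y) = h y ^+ 2 - G y ^+ 2); last by ring.
    by rewrite rmorphB; ring.
  apply: (le_trans (le_normcD _ _)).
  have -> : dist y * ((h y + G y) * (h y ^+ 2 + G y ^+ 2)) =
     dist y * ((h y + G y) * (h y ^+ 2)) + G y ^+ 2 * (dist y * (h y + G y)) by ring.
  have nE : normc E = G y by rewrite normc_gaussE.
  apply: lerD.
    rewrite !normcM normc_real (ger0_norm (sqr_ge0 _)).
    rewrite ler_wpM2l ?normc_ge0 // ler_wpM2r ?sqr_ge0 //.
    by apply: (le_trans (le_normcD _ _)); rewrite Fh nE.
  rewrite normcM normcX nE normc_real normrM ler_wpM2l ?sqr_ge0 //.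
  rewrite (ger0_norm (x := h y + G y)) ?(addr_ge0 _ (ltW g0)) //.
  by rewrite ler_wpM2r ?hG // addr_ge0 // ltW.
(* The [- 1] absorbs the [e] added by each doubling. *)
have early k : dist (2 ^+ k *: x) <= ((C1 + 1) * 4 ^+ k - 1) * e.
  elim: k => [|k IH]; first by rewrite !expr0 scale1r mulr1 addrK FE.
  rewrite exprS -scalerA; set y := 2 ^+ k *: x in IH *.
  apply: (le_trans (double y)).
  have /andP[y0 y1] := h01 y; have /andP[g0 g1] := G1 y.
  have : (h y + G y) * (h y ^+ 2 + G y ^+ 2) <= 2 * 2.
    have ? : h y ^+ 2 <= 1 by rewrite expr_le1.
    have ? : G y ^+ 2 <= 1 by rewrite expr_le1 // ltW.
    by apply: ler_pM; rewrite ?addr_ge0 ?sqr_ge0 //; [exact: ltW|lra|lra].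
  move=> hc; have := ler_wpM2l (normc_ge0 (F y - gaussE A m y)) hc.
  rewrite -/(dist y) (exprS 4 k); lra.
have late k : dist (2 ^+ (k + J.+2) *: x) <= D * e.
  elim: k => [|k IH].
    rewrite add0n; apply: (le_trans (early _)); rewrite -/D.
    by rewrite ler_wpM2r //; lra.
  rewrite addSn exprS -scalerA; set y := 2 ^+ (k + J.+2) *: x in IH *.
  apply: (le_trans (double y)).
  have Gy : G y <= 1 / 2.
    have ay : 1 <= qform A y.
      rewrite /y exprD -scalerA qformZ; apply: (le_trans (shell _ x1 x2)).
      by rewrite ler_peMl ?A0 // !exprn_ege1 // ler1n.
    have := expR_ge1Dx (qform A y); have := expRxMexpNx_1 (qform A y).
    have := expR_gt0 (- qform A y); rewrite -/(G y); nra.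
  have /andP[y0 y1] := h01 y; have /andP[g0 _] := G1 y.
  have hy : h y <= 9 / 16.
    by have := hG y; rewrite -/(dist y) ler_norml -/(G y) => /andP[_]; lra.
  have hy2 : h y ^+ 2 <= 81 / 256 by nra.
  have Gy2 : G y ^+ 2 <= 1 / 4 by nra.
  (* This factor is below [5 / 8], and [4 * e <= D * e] leaves room for the added [e]. *)
  have hc : (h y + G y) * (h y ^+ 2 + G y ^+ 2) <= 17 / 16 * (145 / 256).
    by apply: ler_pM; rewrite ?addr_ge0 ?sqr_ge0 //; [exact: ltW|lra|lra].
  have := ler_wpM2l (normc_ge0 (F y - gaussE A m y)) hc.
  rewrite -/(dist y).
  have : 4 * e <= D * e by rewrite ler_wpM2r.
  lra.
have [nJ|nJ] := leqP J.+2 n; first by have := late (n - J.+2)%N; rewrite subnK.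
apply: (le_trans (early n)); rewrite ler_wpM2r //.
apply: (le_trans (y := (C1 + 1) * 4 ^+ n)); first by lra.
rewrite /D ler_wpM2l ?addr_ge0 //.
by rewrite ler_weXn2l ?ler1n // ltnW.
Qed.

(** * A box adapted to the modulus *)

Lemma normr_det_le (R : realType) (d : nat) (L : R) (V : 'M[R]_d) :
  (forall i, inbox L (row i V)) -> `|\det V| <= d`!%:R * L ^+ d.
Proof.
move=> hV; apply: (le_trans (ler_norm_sum _ _ _)).
rewrite -card_Sn mulr_natl -sumr_const; apply: ler_sum => s _.
rewrite normrM normr_sign mul1r normr_prod -[X in _ ^+ X]card_ord -prodr_const.
apply: ler_prod => i _; rewrite normr_ge0 /=.
by have /inboxP/(_ (s i)) := hV i; rewrite mxE.
Qed.

(* Auerbach's argument: rows of almost maximal determinant, and Cramer's rule. *)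
Lemma exists_auerbach_basis (R : realType) (d : nat) (K : 'rV[R]_d -> Prop) (c L : R) :
  0 < c -> (forall i, K (c *: evec i)) -> (forall t, K t -> inbox L t) ->
  exists V : 'M[R]_d, [/\ V \in unitmx, (forall i, K (row i V))
    & forall t, K t -> inbox 2 (t *m invmx V)].
Proof.
move=> c0 Kc KL.
pose S : set R := fun x => exists2 V : 'M[R]_d, (forall i, K (row i V)) & x = `|\det V|.
have Sub : has_ubound S.
  exists (d`!%:R * L ^+ d) => x [V KV ->].
  by apply: normr_det_le => i; apply: KL.
have Sc : S (c ^+ d).
  exists (c%:M); last by rewrite det_scalar ger0_norm // exprn_ge0 // ltW.
  move=> i; have -> : row i (c%:M : 'M[R]_d) = c *: evec i; last exact: Kc.
  by apply/rowP => j; rewrite !mxE eqxx /= eq_sym; case: eqP; rewrite ?mulr1 ?mulr0.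
have S0 : 0 < sup S by apply: (lt_le_trans _ (ub_le_sup Sub Sc)); rewrite exprn_gt0.
have hS : has_sup S by split => //; exists (c ^+ d).
(* A determinant above half the supremum replaces a maximiser, which may not exist when [K] is not
   closed; hence the [2] in the conclusion. *)
have S2 : 0 < sup S / 2 by rewrite divr_gt0.
have [_ [V KV ->] hV] := sup_adherent S2 hS.
have detV : 0 < `|\det V| by lra.
have uV : V \in unitmx by rewrite unitmxE unitfE -normr_gt0.
exists V; split => // t Kt; apply/inboxP => i.
pose W := \matrix_(k, j) (if k == i then t ord0 j else V k j).
have SW : S `|\det W|.
  exists W => // k; have [->|ki] := eqVneq k i.
    have -> // : row i W = t by apply/rowP => j; rewrite !mxE eqxx.
  have -> // : row k W = row k V by apply/rowP => j; rewrite !mxE (negbTE ki).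
have -> : (t *m invmx V) ord0 i = \det W / \det V.
  rewrite /invmx uV -scalemxAr mxE mulrC; congr (_ / _).
  rewrite (expand_det_row W i) mxE; apply: eq_bigr => j _.
  rewrite !mxE eqxx; congr (_ * _); congr (_ * \det _).
  by apply/matrixP => k l; rewrite !mxE eq_sym (negbTE (neq_lift _ _)).
rewrite normrM normfV ler_pdivrMr //.
have := ub_le_sup Sub SW; lra.
Qed.

(** The star-shaped core of the set where [h >= 1 / 2]: asking for the whole segment makes the set
    stable under shrinking, which the approximate equation alone does not give. *)
Definition superlevel_ray {R : realType} {d : nat} (h : 'rV[R]_d -> R) (t : 'rV[R]_d) : Prop :=
  forall l : R, 0 <= l <= 1 -> 1 / 2 <= h (l *: t).

Lemma superlevel_rayZ (R : realType) (d : nat) (h : 'rV[R]_d -> R) (c : R) (t : 'rV[R]_d) :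
  (forall t, h (- t) = h t) -> `|c| <= 1 -> superlevel_ray h t -> superlevel_ray h (c *: t).
Proof.
move=> hN c1 ht l /andP[l0 l1].
have hc : 1 / 2 <= h ((l * `|c|) *: t).
  by apply: ht; rewrite mulr_ge0 //= mulr_ile1.
rewrite scalerA; have [c0|c0] := lerP 0 c; first by rewrite ger0_norm in hc.
by rewrite ltr0_norm // mulrN scaleNr hN in hc.
Qed.

(* Halving [s] and [t] raises [h] above [1/2], which leaves room for the error. *)
Lemma superlevel_rayD (R : realType) (d : nat) (h : 'rV[R]_d -> R) (e : R) (s t : 'rV[R]_d) :
  approx_exp_form h e -> e <= 1 / 20 -> superlevel_ray h s -> superlevel_ray h t ->
  superlevel_ray h (4^-1 *: (s + t)).
Proof.
move=> [h0 h01 hN hfe] e20 hs ht l l01.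
have e0 : 0 <= e by apply: le_trans (hfe 0 0); apply: normr_ge0.
have halve y : h (2 *: y) - e <= (h y ^+ 2) ^+ 2.
  have := hfe y y; rewrite subrr h0 mulr1 scaler_nat mulr2n -expr2 ler_norml => /andP[_]; lra.
(* One halving lifts [1 / 2] to [4 / 5], since [(4 / 5) ^+ 4 < 1 / 2 - e]; the next one lifts the
   fourth power to [4 / 5 - e >= 3 / 4]. *)
have quarter y : 1 / 2 <= h y -> 3 / 4 <= (h (4^-1 *: y) ^+ 2) ^+ 2.
  move=> hy.
  have := halve (2^-1 *: y); rewrite scalerA divff // scale1r => h1.
  have := halve (4^-1 *: y); rewrite scalerA.
  have -> : 2 / 4 = 2^-1 :> R by field.
  have /andP[a0 a1] := h01 (2^-1 *: y).
  have a8 : 4 / 5 <= h (2^-1 *: y).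
    rewrite leNgt; apply/negP => a8.
    have : h (2^-1 *: y) ^+ 2 < 16 / 25 by nra.
    have : 0 <= h (2^-1 *: y) ^+ 2 by apply: sqr_ge0.
    nra.
  lra.
rewrite scalerA (mulrC l) -scalerA !scalerDr.
set x := l *: s; set y := l *: t.
have hx := quarter _ (hs _ l01 : 1 / 2 <= h x).
have hy := quarter _ (ht _ l01 : 1 / 2 <= h y).
have := hfe (4^-1 *: x) (4^-1 *: y).
have /andP[u0 u1] := h01 (4^-1 *: x + 4^-1 *: y).
have /andP[v0 v1] := h01 (4^-1 *: x - 4^-1 *: y).
move: hx hy; have := sqr_ge0 (h (4^-1 *: x)); have := sqr_ge0 (h (4^-1 *: y)).
set b := _ ^+ 2; set a := _ ^+ 2 => b0 a0 ha hb.
have hab : 3 / 4 <= a * b.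
  rewrite leNgt; apply/negP => ab.
  have ab0 : 0 <= a * b by rewrite mulr_ge0.
  have : (a * b) ^+ 2 < 9 / 16 by nra.
  rewrite exprMn; nra.
rewrite ler_norml => /andP[h1 _].
have : h (4^-1 *: x + 4^-1 *: y) * h (4^-1 *: x - 4^-1 *: y) <= h (4^-1 *: x + 4^-1 *: y).
  by rewrite ler_piMr.
lra.
Qed.

(** The set is almost convex with a loss of [4] per sum, and [d] basis vectors are added one at a
    time. *)
Lemma superlevel_ray_box (R : realType) (d : nat) (h : 'rV[R]_d -> R) (e : R) (V : 'M[R]_d) :
  approx_exp_form h e -> e <= 1 / 20 -> (forall i, superlevel_ray h (row i V)) ->
  forall x, inbox 1 x -> superlevel_ray h ((4 ^+ d)^-1 *: (x *m V)).
Proof.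
move=> hh e20 hV x x1; have [h0 h01 hN hfe] := hh.
suff part k : (k <= d)%N -> superlevel_ray h ((4 ^+ k)^-1 *: (row_trunc x k *m V)).
  by have := part d (leqnn d); rewrite row_trunc_full.
elim: k => [|k IH] kd.
  by move=> l _; rewrite row_trunc0 mul0mx !scaler0 h0; lra.
have tk := row_truncS x (Ordinal kd); rewrite /= in tk.
rewrite tk mulmxDl -scalemxAl -rowE exprS invfM -scalerA scalerDr.
apply: (superlevel_rayD hh e20); first exact: IH (ltnW kd).
rewrite scalerA; apply: superlevel_rayZ => //.
rewrite normrM mulr_ile1 ?normr_ge0 //.
  by rewrite gtr0_norm ?invr_gt0 ?exprn_gt0 // invf_le1 ?exprn_gt0 // exprn_ege1 // ler1n.
by move/inboxP: x1; apply.
Qed.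

(** Continuity at the origin with value [1]. The radii it provides never enter the final
    constants. *)
Definition near1 {R : realType} {d : nat} (F : 'rV[R]_d -> R[i]) : Prop :=
  forall c : R, 0 < c -> exists2 r : R, 0 < r & forall x, inbox r x -> normc (F x - 1) <= c.

Lemma inbox_mulmx (R : realType) (d n : nat) (M : 'M[R]_(d, n)) (r : R) (x : 'rV[R]_d) :
  inbox r x -> inbox (r * \sum_i \sum_j `|M i j|) (x *m M).
Proof.
move=> /inboxP hx; apply/inboxP => j; rewrite mxE.
apply: (le_trans (ler_norm_sum _ _ _)); rewrite mulr_sumr; apply: ler_sum => i _.
rewrite normrM; apply: ler_pM => //.
by rewrite (bigD1 j) //= lerDl sumr_ge0.
Qed.

Lemma near1_mulmx (R : realType) (d : nat) (F : 'rV[R]_d -> R[i]) (M : 'M[R]_d) :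
  near1 F -> near1 (fun x => F (x *m M)).
Proof.
move=> hF c c0; have [r r0 hr] := hF c c0.
pose B := \sum_i \sum_j `|M i j|.
have B0 : 0 <= B by rewrite sumr_ge0 // => i _; rewrite sumr_ge0.
exists (r / (B + 1)) => [|x /(inbox_mulmx M) hx]; first by rewrite divr_gt0 // ltr_wpDl.
apply: hr; apply: inboxW hx.
by rewrite -/B mulrAC ler_pdivrMr ?ltr_wpDl // ler_pM2l //; lra.
Qed.

(** The equation involves only the additive structure, so a linear change of variables keeps the
    same [e]; this permits normalising the box. *)
Lemma approx_exp_form_mulmx (R : realType) (d : nat) (h : 'rV[R]_d -> R) (e : R) (M : 'M[R]_d) :
  approx_exp_form h e -> approx_exp_form (fun x => h (x *m M)) e.
Proof.
move=> [h0 h01 hN hfe]; split=> [|//|t|s t]; first by rewrite mul0mx.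
  by rewrite mulNmx hN.
by rewrite mulmxDl mulmxBl.
Qed.

Lemma approx_gauss_cf_mulmx (R : realType) (d : nat) (F : 'rV[R]_d -> R[i])
    (h : 'rV[R]_d -> R) (e : R) (M : 'M[R]_d) :
  approx_gauss_cf F h e -> approx_gauss_cf (fun x => F (x *m M)) (fun x => h (x *m M)) e.
Proof.
move=> [F0 Fh Ffe]; split=> [|//|s t]; first by rewrite mul0mx.
by rewrite mulmxDl mulmxBl.
Qed.

Lemma qform_mulmx (R : realType) (d : nat) (A N : 'M[R]_d) (t : 'rV[R]_d) :
  qform A (t *m N) = qform (N *m A *m N^T) t.
Proof. by rewrite /qform trmx_mul !mulmxA. Qed.

Lemma dotvE (R : realType) (d : nat) (t m : 'rV[R]_d) : dotv t m = (t *m m^T) ord0 ord0.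
Proof. by rewrite mxE; apply: eq_bigr => i _; rewrite mxE. Qed.

Lemma gaussE_mulmx (R : realType) (d : nat) (A N : 'M[R]_d) (m t : 'rV[R]_d) :
  gaussE A m (t *m N) = gaussE (N *m A *m N^T) (m *m N^T) t.
Proof. by rewrite /gaussE qform_mulmx !dotvE trmx_mul trmxK mulmxA. Qed.

(* [1184 = 1024 + 160], from the phase and the modulus; the box has side [4], its basis is
   scaled by [4 ^- d.+1] and [h] drops below [1/2] within [2 * 4 ^ d.+1 = 2 ^ (2 * d + 3)]. *)
Definition box_const {R : realType} (d : nat) : R := (1184 * d.+1 ^ 2)%:R.
Definition stab_const {R : realType} (d : nat) : R :=
  (box_const d + 1) * 4 ^+ (2 * d + 3).+2.

(** The basis and [A] are built from the shared modulus [h], so they serve [F] and [H] alike; only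
    the phases are fitted separately. The radius [L] serves to make the determinants bounded and
    enters no constant. *)
Lemma approx_gauss_cf_pair_stable (R : realType) (d : nat) (F H : 'rV[R]_d -> R[i])
    (h : 'rV[R]_d -> R) (e L : R) :
  approx_exp_form h e -> approx_gauss_cf F h e -> approx_gauss_cf H h e ->
  near1 F -> near1 H -> (forall t, 1 / 2 <= h t -> inbox L t) ->
  stab_const d * e <= 1 / 16 ->
  exists (A : 'M[R]_d) (mF mH : 'rV[R]_d),
    [/\ A^T = A, (forall t, 0 <= qform A t),
        (forall t, normc (F t - gaussE A mF t) <= stab_const d * e)
      & (forall t, normc (H t - gaussE A mH t) <= stab_const d * e)].
Proof.
move=> hh hF hH nF nH hL e_small; have [h0 h01 hN hfe] := hh.
have e0 : 0 <= e by apply: le_trans (hfe 0 0); apply: normr_ge0.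
have d1 : 1 <= d.+1%:R :> R by rewrite ler1n.
have box0 : 0 <= box_const d :> R by rewrite /box_const ler0n.
have boxE : box_const d = 1184 * d.+1%:R ^+ 2 :> R by rewrite /box_const natrM natrX.
have d2 : d.+1%:R <= d.+1%:R ^+ 2 :> R by rewrite expr2 ler_peMl.
(* The exponent of [4] in [stab_const] is at least [5], and [4 ^+ 5 = 1024]; all smallness
   conditions of the box lemmas follow from this. *)
have smallC : 16 * 1024 * (1184 * d.+1%:R ^+ 2 * e) <= 1.
  have : 1024 <= (4 : R) ^+ (2 * d + 3).+2.
    rewrite -!addnS exprD; have : 1 <= (4 : R) ^+ (2 * d) by rewrite exprn_ege1 // ler1n.
    rewrite !exprS expr0; lra.
  move: e_small; rewrite /stab_const boxE; set k := 4 ^+ _ => e_small hk.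
  have x0 : 0 <= 1184 * d.+1%:R ^+ 2 * e :> R.
    apply: mulr_ge0; last exact: e0.
    by apply: mulr_ge0; [exact: ler0n | exact: sqr_ge0].
  rewrite mulrDl mul1r in e_small.
  move: e_small x0; set x := 1184 * _ * e => e_small x0.
  have hx : x * 1024 <= x * k by rewrite ler_wpM2l.
  have : 0 <= e * k by apply: mulr_ge0 => //; apply: le_trans hk; exact: ler0n.
  move: e_small; rewrite mulrDl [e * k]mulrC.
  rewrite -[_ * k * e]mulrAC -/x; lra.
have de : d.+1%:R * e <= d.+1%:R ^+ 2 * e by rewrite ler_wpM2r.
have ee : e <= d.+1%:R * e by rewrite ler_peMl.
have e20 : e <= 1 / 20 by lra.
have Fh t : normc (F t) = h t by case: hF.
have [r r0 hr] := nF (1 / 2) ltac:(lra).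
have [||V [uV KV VK]] := @exists_auerbach_basis R d (superlevel_ray h) r L r0.
- move=> i l /andP[l0 l1].
  have : inbox r (l *: (r *: evec i) : 'rV[R]_d).
    by rewrite scalerA; apply: inbox_evec; rewrite ger0_norm ?mulr_ge0 ?ler_piMl // ltW.
  by move/hr; have := ler_normc_dist (F (l *: (r *: evec i))) 1;
    rewrite Fh normc1 ler_norml => /andP[? _] ?; lra.
- by move=> t /(_ 1); rewrite lexx ler01 scale1r => /(_ isT); apply: hL.
(* The power [4 ^+ d] is the loss in [superlevel_ray_box]; the extra [4] enlarges the unit box to
   radius [4]. *)
pose k : R := (4 ^+ d.+1)^-1.
have k0 : 0 < k by rewrite invr_gt0 exprn_gt0.
pose M := k *: V.
have uM : M \in unitmx by rewrite unitmxZ // unitfE gt_eqF.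
have hhM := approx_exp_form_mulmx M hh.
have box4 x : inbox 4 x -> 1 / 2 <= h (x *m M).
  move=> x4; have := @superlevel_ray_box R d h e V hh e20 KV (4^-1 *: x).
  have -> : inbox 1 (4^-1 *: x) by have := inboxZ 4^-1 x4; rewrite ger0_norm ?invr_ge0 // mulVf.
  move=> /(_ isT 1); rewrite lexx ler01 => /(_ isT).
  by rewrite scale1r -scalemxAl scalerA -invfM -exprSr -/k scalemxAr.
have exitM t : ~~ inbox (2 ^+ (2 * d + 3)) t ->
    exists2 l : R, 0 <= l <= 1 & h ((l *: t) *m M) < 1 / 2.
  move=> ht; apply: contrapT => hno; move/negP: ht; apply.
  have : superlevel_ray h (t *m M).
    move=> l l01; rewrite leNgt; apply/negP => hl; apply: hno; exists l => //.
    by rewrite -scalemxAl.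
  move/VK; rewrite /M -scalemxAr -scalemxAl mulmxK // => /(inboxZ k^-1).
  rewrite scalerA mulVf ?gt_eqF // scale1r gtr0_norm ?invr_gt0 // invrK.
  apply: inboxW; rewrite exprD exprM (exprS 4 d).
  have e22 : (2 : R) ^+ 2 = 4 by ring.
  have e23 : (2 : R) ^+ 3 = 8 by ring.
  have : 0 <= (4 : R) ^+ d by rewrite exprn_ge0.
  rewrite e22 e23; lra.
have [A AT hA] := @approx_exp_form_box R d _ e hhM box4
  ltac:(rewrite natrM natrX; lra).
have fit G : approx_gauss_cf G h e -> near1 G -> exists m : 'rV[R]_d,
    (forall t, 0 <= qform A t) /\
    (forall t, normc (G (t *m M) - gaussE A m t) <= stab_const d * e).
  move=> hG nG.
  have c16 : 0 < 1 / 16 :> R by lra.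
  have [r' r'0 hr'] := near1_mulmx M nG c16.
  have [|m hm] := @approx_gauss_cf_phase_box R d _ _ e r' hhM
    (approx_gauss_cf_mulmx M hG) box4 r'0 hr'.
    by rewrite natrM; lra.
  exists m; apply: (approx_gauss_cf_extend hhM (approx_gauss_cf_mulmx M hG) box0 _ exitM e_small).
  move=> x x1; apply: (le_trans (normc_dist ((h (x *m M))%:C * expi (dotv x m)) _ _)).
  rewrite /gaussE -mulrBl -rmorphB normcM normc_expi mulr1 normc_real.
  apply: (le_trans (lerD (hm _ x1) (hA _ x1))); rewrite boxE !natrM; lra.
have [mF [A0 hmF]] := fit F hF nF; have [mH [_ hmH]] := fit H hH nH.
pose N := invmx M.
exists (N *m A *m N^T), (mF *m N^T), (mH *m N^T); split.
- by rewrite !trmx_mul trmxK AT mulmxA.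
- by move=> t; rewrite -qform_mulmx.
- by move=> t; rewrite -gaussE_mulmx; have := hmF (t *m N); rewrite mulmxKV.
- by move=> t; rewrite -gaussE_mulmx; have := hmH (t *m N); rewrite mulmxKV.
Qed.

(** * Pairs satisfying the perturbed Bernstein equation *)

(** The last clause perturbs the functional equation behind Bernstein's theorem. Damping amounts to
    adding independent Gaussian noise; stating the properties for arbitrary functions avoids
    enlarging the probability space for it. *)
Definition bernstein_pair {R : realType} {d : nat} (f1 f2 : 'rV[R]_d -> R[i]) (eta : R) : Prop :=
  [/\ f1 0 = 1 /\ f2 0 = 1,
      (forall t, normc (f1 t) <= 1 /\ normc (f2 t) <= 1),
      (forall t, f1 (- t) = conjc (f1 t) /\ f2 (- t) = conjc (f2 t))
    & forall s t, normc (f1 (s + t) * f2 (s - t) - f1 s * f2 s * (f1 t * f2 (- t))) <= eta].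

Lemma mulc_conj (R : realType) (z : R[i]) : z * conjc z = (normc z ^+ 2)%:C.
Proof.
case: z => a b; rewrite /= sqr_sqrtr ?addr_ge0 ?sqr_ge0 //; simpc.
by congr (_ +i* _); ring.
Qed.

Lemma near1M (R : realType) (d : nat) (f g : 'rV[R]_d -> R[i]) :
  near1 f -> near1 g -> near1 (fun t => f t * g t).
Proof.
move=> hf hg c c0; pose c' := Num.min (c / 3) 1.
have c'0 : 0 < c' by rewrite lt_min divr_gt0 // ltr01.
have [c3 c1] : c' <= c / 3 /\ c' <= 1 by rewrite /c' !ge_min !lexx orbT.
have [r1 r10 h1] := hf c' c'0; have [r2 r20 h2] := hg c' c'0.
exists (Num.min r1 r2) => [|t ht]; first by rewrite lt_min r10.
have {}h1 : normc (f t - 1) <= c' by apply: h1; apply: inboxW ht; rewrite ge_min lexx.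
have {}h2 : normc (g t - 1) <= c'.
  by apply: h2; apply: inboxW ht; rewrite ge_min lexx orbT.
have -> : f t * g t - 1 = (f t - 1) * (g t - 1) + ((f t - 1) + (g t - 1)) by ring.
apply: (le_trans (le_normcD _ _)); rewrite normcM.
have := le_normcD (f t - 1) (g t - 1).
have : normc (f t - 1) * normc (g t - 1) <= c' * 1.
  by apply: ler_pM; rewrite ?normc_ge0 // (le_trans h2).
lra.
Qed.

Lemma near1_opp (R : realType) (d : nat) (f : 'rV[R]_d -> R[i]) :
  near1 f -> near1 (fun t => f (- t)).
Proof.
move=> hf c c0; have [r r0 hr] := hf c c0.
by exists r => // t ht; apply: hr; rewrite inboxN.
Qed.

(** Regrouping the four factors of [F (s + t) * F (s - t)] gives the equation at [s, t] and at
    [s, - t]; for [H] it is used at [t, s] and [- t, s]. Two uses double [eta], and moduli give the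
    claim for [h]. *)
Lemma bernstein_pair_products (R : realType) (d : nat) (f1 f2 : 'rV[R]_d -> R[i]) (eta : R) :
  bernstein_pair f1 f2 eta ->
  let h t := normc (f1 t) * normc (f2 t) in
  [/\ approx_exp_form h (eta + eta), approx_gauss_cf (fun t => f1 t * f2 t) h (eta + eta)
    & approx_gauss_cf (fun t => f1 t * f2 (- t)) h (eta + eta)].
Proof.
move=> [[f10 f20] fle fN fe] h.
have fle2 (u v : 'rV[R]_d) : normc (f1 u * f2 v) <= 1.
  by rewrite normcM mulr_ile1 ?normc_ge0 // ?(fle u).1 ?(fle v).2.
have hsq t : (h t ^+ 2)%:C = f1 t * f1 (- t) * (f2 t * f2 (- t)).
  by rewrite (fN t).1 (fN t).2 !mulc_conj -rmorphM /h exprMn.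
have hF : approx_gauss_cf (fun t => f1 t * f2 t) h (eta + eta).
  split=> [|t|s t]; first by rewrite f10 f20 mulr1.
    by rewrite normcM.
  have -> : f1 (s + t) * f2 (s + t) * (f1 (s - t) * f2 (s - t))
     = f1 (s + t) * f2 (s - t) * (f1 (s - t) * f2 (s + t)) by ring.
  have -> : (f1 s * f2 s) ^+ 2 * (h t ^+ 2)%:C =
     f1 s * f2 s * (f1 t * f2 (- t)) * (f1 s * f2 s * (f1 (- t) * f2 t)).
    by rewrite hsq; ring.
  apply: normcM_dist_le1 => //.
    by rewrite normcM mulr_ile1 ?normc_ge0.
  by have := fe s (- t); rewrite !opprK.
have hH : approx_gauss_cf (fun t => f1 t * f2 (- t)) h (eta + eta).
  split=> [|t|s t]; first by rewrite oppr0 f10 f20 mulr1.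
    by rewrite normcM (fN t).2 normc_conj.
  have -> : f1 (s + t) * f2 (- (s + t)) * (f1 (s - t) * f2 (- (s - t)))
     = f1 (t + s) * f2 (t - s) * (f1 (- t + s) * f2 (- t - s)).
    rewrite (addrC t s) opprD opprB (addrC (- t) s) [- t - s]addrC; ring.
  have -> : (f1 s * f2 (- s)) ^+ 2 * (h t ^+ 2)%:C =
     f1 t * f2 t * (f1 s * f2 (- s)) * (f1 (- t) * f2 (- t) * (f1 s * f2 (- s))).
    by rewrite hsq; ring.
  apply: normcM_dist_le1 => //.
  by rewrite normcM mulr_ile1 ?normc_ge0.
split=> //; have [F0 Fh Ffe] := hF; split=> [|t|t|s t].
- by rewrite -Fh F0 normc1.
- by rewrite -Fh normc_ge0 fle2.
- by rewrite /h (fN t).1 (fN t).2 !normc_conj.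
- apply: le_trans (Ffe s t); apply: le_trans (ler_normc_dist _ _).
  by rewrite !normcM normc_real (ger0_norm (sqr_ge0 _)).
Qed.

Lemma conjcM (R : realType) (x y : R[i]) : conjc (x * y) = conjc x * conjc y.
Proof. exact: rmorphM. Qed.

Lemma conjcB (R : realType) (x y : R[i]) : conjc (x - y) = conjc x - conjc y.
Proof. exact: rmorphB. Qed.

Lemma gauss_cfE (R : realType) (d : nat) (m : 'rV[R]_d) (Q : 'M[R]_d) (t : 'rV[R]_d) :
  gauss_cf m Q t = (expR (- (1 / 2) * qform Q t))%:C * expi (dotv t m).
Proof. by rewrite /gauss_cf /expi /qform; simpc. Qed.

(** Twice the form at half the argument is half the form at [t], so the fitted [A] is itself the
    covariance. *)
Lemma gauss_cf_prod (R : realType) (d : nat) (m m' : 'rV[R]_d) (A : 'M[R]_d) (t : 'rV[R]_d) :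
  gaussE A m (2^-1 *: t) * gaussE A m' (2^-1 *: t) = gauss_cf (2^-1 *: (m + m')) A t.
Proof.
rewrite gauss_cfE /gaussE mulrACA -rmorphM -expRD -expiD qformZ -!dotvDr dotvZl dotvZr.
by congr ((expR _)%:C * _); field.
Qed.

Lemma conj_gaussE (R : realType) (d : nat) (A : 'M[R]_d) (m t : 'rV[R]_d) :
  conjc (gaussE A m t) = gaussE A (- m) t.
Proof. by rewrite /gaussE conjcM conj_expi conjc_real dotvNr. Qed.

(** Two factors, each with error [stab_const d * (eta + eta)], and one [eta] from the equation. *)
Definition final_const {R : realType} (d : nat) : R := 4 * stab_const d + 1.

Lemma bernstein_pair_stable_decay (R : realType) (d : nat) (f1 f2 : 'rV[R]_d -> R[i])
    (eta L : R) :
  bernstein_pair f1 f2 eta -> near1 f1 -> near1 f2 ->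
  (forall t, 1 / 2 <= normc (f1 t) -> inbox L t) ->
  stab_const d * (eta + eta) <= 1 / 16 ->
  exists (m1 m2 : 'rV[R]_d) (Q : 'M[R]_d), [/\ Q^T = Q, (forall t, 0 <= qform Q t)
    & forall t, normc (f1 t - gauss_cf m1 Q t) <= final_const d * eta /\
                normc (f2 t - gauss_cf m2 Q t) <= final_const d * eta].
Proof.
move=> hf n1 n2 hL eta_small.
have [hh hF hH] := bernstein_pair_products hf.
have [[f10 f20] fle fN fe] := hf.
have [|A [mF [mH [AT A0 hmF hmH]]]] := approx_gauss_cf_pair_stable (L := L) hh hF hH
  (near1M n1 n2) (near1M n1 (near1_opp n2)) _ eta_small.
  move=> t ht; apply: hL; apply: (le_trans ht).
  by rewrite ler_piMr ?normc_ge0 // (fle t).2.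
have G1 m t : normc (gaussE A m t) <= 1 by rewrite normc_gaussE expR_le1 oppr_le0.
have fle2 (u v : 'rV[R]_d) : normc (f1 u * f2 v) <= 1.
  by rewrite normcM mulr_ile1 ?normc_ge0 // ?(fle u).1 ?(fle v).2.
(* The phases add in [F * H] and subtract in [F * conjc H]; the half comes from evaluating at
   [t / 2]. *)
exists (2^-1 *: (mF + mH)), (2^-1 *: (mF - mH)), A; split => // t.
set u := 2^-1 *: t.
have uu : u + u = t by apply/rowP => i; rewrite !mxE; field.
have cE : final_const d * eta = eta + (stab_const d * (eta + eta) + stab_const d * (eta + eta)).
  by rewrite /final_const; ring.
rewrite -!gauss_cf_prod -/u -conj_gaussE cE; split.
  apply: (le_trans (normc_dist (f1 u * f2 u * (f1 u * f2 (- u))) _ _)); apply: lerD.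
    by have := fe u u; rewrite subrr f20 mulr1 uu.
  exact: normcM_dist_le1.
apply: (le_trans (normc_dist (f1 u * f2 u * conjc (f1 u * f2 (- u))) _ _)); apply: lerD.
  have := fe u (- u); rewrite subrr f10 mul1r opprK uu conjcM (fN u).1 (fN u).2.
  by rewrite conjcK.
apply: normcM_dist_le1 => //; first by rewrite normc_conj.
by rewrite -conjcB normc_conj.
Qed.

(** * Removing the decay hypothesis *)

Local Open Scope classical_set_scope.

Lemma rV_bounded_cluster (R : realType) (N : nat) (u : nat -> 'rV[R]_N) (B : R) :
  (forall n, inbox B (u n)) ->
  exists l, forall e : R, 0 < e -> forall n, exists2 k, (n <= k)%N & inbox e (u k - l).
Proof.
move=> uB; pose K := [set v : 'rV[R]_N | forall i, `[- B, B] (v ord0 i)].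
have cK : compact K.
  by apply: (@rV_compact R N (fun=> `[- B, B])) => i; apply: segment_compact.
have uK : (u @ \oo) K.
  by exists 0%N => // n _ i /=; rewrite in_itv /= -ler_norml; move: i; apply/inboxP.
have [l [_ hl]] := cK (u @ \oo) _ uK.
exists l => e e0 n.
have [] := hl (u @` [set k | (n <= k)%N]) (ball l e).
- by apply: filterS (nbhs_infty_ge n) => k nk; exists k.
- exact: nbhsx_ballx.
move=> _ [[k nk <-] [_ hb]]; exists k => //; apply/inboxP => i.
by rewrite !mxE distrC; apply: ltW; apply: hb.
Qed.

Lemma inbox_row_mx (R : realType) (m n : nat) (r : R) (x : 'rV[R]_m) (y : 'rV[R]_n) :
  inbox r (row_mx x y) = inbox r x && inbox r y.
Proof.
apply/idP/andP => [/inboxP h|[/inboxP hx /inboxP hy]].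
  split; apply/inboxP => i.
    by have := h (lshift n i); rewrite row_mxEl.
  by have := h (rshift m i); rewrite row_mxEr.
by apply/inboxP => i; case: (split_ordP i) => j ->; rewrite ?row_mxEl ?row_mxEr.
Qed.

Lemma inbox_mxvec (R : realType) (m n : nat) (r : R) (Q : 'M[R]_(m, n)) :
  inbox r (mxvec Q) <-> (forall i j, `|Q i j| <= r).
Proof.
split=> [/inboxP h i j|h]; first by rewrite -mxvecE.
by apply/inboxP => k; case/mxvec_indexP: k => i j; rewrite mxvecE.
Qed.

(** Packing all parameters into one row vector makes the indices [k] common to the three
    sequences. *)
Lemma gauss_params_cluster (R : realType) (d : nat) (m1 m2 : nat -> 'rV[R]_d)
    (Q : nat -> 'M[R]_d) (B : R) :
  (forall n, inbox B (m1 n)) -> (forall n, inbox B (m2 n)) ->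
  (forall n i j, `|Q n i j| <= B) ->
  exists (l1 l2 : 'rV[R]_d) (P : 'M[R]_d), forall e : R, 0 < e -> forall n,
    exists2 k, (n <= k)%N &
      [/\ inbox e (m1 k - l1), inbox e (m2 k - l2) & forall i j, `|(Q k - P) i j| <= e].
Proof.
move=> B1 B2 BQ.
have [|l hl] := @rV_bounded_cluster R _
    (fun n => row_mx (row_mx (m1 n) (m2 n)) (mxvec (Q n))) B.
  by move=> n; rewrite !inbox_row_mx B1 B2; apply/inbox_mxvec.
exists (lsubmx (lsubmx l)), (rsubmx (lsubmx l)), (vec_mx (rsubmx l)) => e e0 n.
have [k nk hk] := hl e e0 n; exists k => //.
move: hk; rewrite -{1}[l]hsubmxK -{1}[lsubmx l]hsubmxK -{1}[rsubmx l]vec_mxK.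
rewrite !opp_row_mx !add_row_mx !inbox_row_mx.
have <- := linearB mxvec (Q k) (vec_mx (rsubmx l)).
by move=> /andP[/andP[h1 h2] /inbox_mxvec h3].
Qed.

Definition l1norm {R : realType} {d : nat} (t : 'rV[R]_d) : R := \sum_i `|t ord0 i|.

Lemma l1norm_ge0 (R : realType) (d : nat) (t : 'rV[R]_d) : 0 <= l1norm t.
Proof. by rewrite sumr_ge0. Qed.

Lemma normr_dotv_le (R : realType) (d : nat) (e : R) (t m : 'rV[R]_d) :
  inbox e m -> `|dotv t m| <= e * l1norm t.
Proof.
move=> /inboxP hm; apply: (le_trans (ler_norm_sum _ _ _)).
rewrite mulr_sumr; apply: ler_sum => i _.
by rewrite normrM mulrC ler_wpM2r.
Qed.

Lemma normr_qform_le (R : realType) (d : nat) (e : R) (Q : 'M[R]_d) (t : 'rV[R]_d) :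
  (forall i j, `|Q i j| <= e) -> `|qform Q t| <= e * l1norm t ^+ 2.
Proof.
move=> hQ; rewrite /qform mxE; apply: (le_trans (ler_norm_sum _ _ _)).
rewrite expr2 mulrA {2}/l1norm mulr_sumr; apply: ler_sum => j _.
rewrite normrM !mxE ler_wpM2r //; apply: (le_trans (ler_norm_sum _ _ _)).
rewrite mulr_sumr; apply: ler_sum => i _.
by rewrite normrM mulrC ler_wpM2r.
Qed.

Lemma qformB (R : realType) (d : nat) (Q P : 'M[R]_d) (t : 'rV[R]_d) :
  qform (Q - P) t = qform Q t - qform P t.
Proof. by rewrite /qform mulmxBr mulmxBl !mxE. Qed.

Lemma expRN_lipschitz (R : realType) (x y : R) : 0 <= x -> 0 <= y ->
  `|expR (- x) - expR (- y)| <= `|x - y|.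
Proof.
wlog xy : x y / x <= y => [H x0 y0|x0 _].
  by case: (leP x y) => [/H|/ltW/H]; last rewrite distrC (distrC x); apply.
have -> : expR (- x) - expR (- y) = expR (- x) * (1 - expR (- (y - x))).
  by rewrite mulrBr mulr1 -expRD; congr (_ - expR _); ring.
have h1 := expR_ge1Dx (- (y - x)).
have h2 : 0 <= 1 - expR (- (y - x)) by rewrite subr_ge0 expR_le1 oppr_le0 subr_ge0.
rewrite distrC normrM (gtr0_norm (expR_gt0 _)) (ger0_norm h2) (ger0_norm (x := y - x)); last lra.
apply: (le_trans (y := 1 - expR (- (y - x)))); last by lra.
by rewrite ler_piMl // expR_le1 oppr_le0.
Qed.

Lemma gauss_cf_dist (R : realType) (d : nat) (e : R) (m l : 'rV[R]_d) (Q P : 'M[R]_d)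
    (t : 'rV[R]_d) :
  0 <= qform Q t -> 0 <= qform P t -> inbox e (m - l) -> (forall i j, `|(Q - P) i j| <= e) ->
  normc (gauss_cf m Q t - gauss_cf l P t) <= e * (l1norm t ^+ 2 + 2 * l1norm t).
Proof.
move=> Q0 P0 hm hQ; rewrite !gauss_cfE.
apply: (le_trans (normcM_dist _ _ _ _)); rewrite -rmorphB !normc_real normc_expi mulr1 mulrDr.
apply: lerD.
  rewrite !mulNr; apply: (le_trans (expRN_lipschitz _ _)); rewrite ?mulr_ge0 //; try lra.
  rewrite -mulrBr -qformB normrM ger0_norm; last by lra.
  have := normr_qform_le t hQ; have := normr_ge0 (qform (Q - P) t); lra.
have g1 : `|expR (- (1 / 2) * qform P t)| <= 1.
  by rewrite gtr0_norm ?expR_gt0 // expR_le1 mulNr oppr_le0 mulr_ge0 //; lra.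
have hd := normr_dotv_le t hm.
have := normc_expi_dist (dotv t m) (dotv t l).
have -> : dotv t m - dotv t l = dotv t (m - l) by rewrite dotvDr dotvNr.
move=> h2; apply: (le_trans (y := 1 * (2 * (e * l1norm t)))); last by lra.
by apply: ler_pM; rewrite ?normc_ge0 //; lra.
Qed.

Lemma qform_evec (R : realType) (d : nat) (Q : 'M[R]_d) (c : R) (i j : 'I_d) :
  qform Q (evec i + c *: evec j) = Q i i + c * (Q i j + Q j i) + c ^+ 2 * Q j j.
Proof.
pose b (x y : 'rV[R]_d) := (x *m Q *m y^T) ord0 ord0.
have bE k l : b (evec k) (evec l) = Q k l by rewrite /b -rowE trmx_delta -colE !mxE.
have bDl x y z : b (x + y) z = b x z + b y z by rewrite /b !mulmxDl mxE.
have bDr x y z : b x (y + z) = b x y + b x z by rewrite /b linearD mulmxDr mxE.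
have bZl a x y : b (a *: x) y = a * b x y by rewrite /b -!scalemxAl mxE.
have bZr a x y : b x (a *: y) = a * b x y by rewrite /b linearZ -scalemxAr mxE.
by rewrite -[qform _ _]/(b _ _) !(bDl, bDr, bZl, bZr, bE); ring.
Qed.

(** A mean coordinate above [2 / r] would turn the phase by [pi / 2 < 2] inside the box, where the
    real part vanishes. The modulus bounds the diagonal of [Q], and semi-definiteness on
    [evec i + evec j] and [evec i - evec j] bounds the other entries. *)
Lemma gauss_cf_params_bound (R : realType) (d : nat) (r : R) (m : 'rV[R]_d) (Q : 'M[R]_d) :
  0 < r -> Q^T = Q -> (forall t, 0 <= qform Q t) ->
  (forall t, inbox r t -> normc (gauss_cf m Q t - 1) <= 1 / 2) ->
  inbox (2 / r) m /\ forall i j, `|Q i j| <= 2 / r ^+ 2.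
Proof.
move=> r0 QT Q0 hr; split.
  apply/inboxP => i; rewrite leNgt; apply/negP => mi.
  have m0 : 0 < `|m ord0 i| by apply: lt_trans mi; rewrite divr_gt0.
  have m0' : m ord0 i != 0 by rewrite -normr_gt0.
  pose c := pi / 2 / m ord0 i.
  have cr : `|c| <= r.
    rewrite /c normrM normfV ger0_norm ?divr_ge0 ?pi_ge0 // ler_pdivrMr //.
    by rewrite ltr_pdivrMr // mulrC in mi; have := pihalf_lt2 R; lra.
  have := hr _ (inbox_evec i cr); rewrite gauss_cfE dotvZl.
  have -> : dotv (evec i) m = m ord0 i.
    by rewrite dotvE -rowE !mxE.
  rewrite /c divfK // /expi cos_pihalf sin_pihalf.
  set a := expR _ => h; have := le_trans (normc_Re _) h.
  by rewrite raddfB /= !mulr0 mul0r subrr sub0r normrN normr1; lra.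
have Qii i : 0 <= Q i i <= 2 / r ^+ 2.
  have qE : qform Q (evec i) = Q i i.
    by have := qform_evec Q 0 i i; rewrite scale0r addr0 => ->; ring.
  rewrite -{1}qE Q0 /= ler_pdivlMr ?exprn_gt0 // mulrC -qE -qformZ.
  have ri : inbox r (r *: evec i : 'rV[R]_d) by apply: inbox_evec; rewrite gtr0_norm.
  have h := hr _ ri; have := le_trans (ler_normc_dist _ _) h.
  rewrite gauss_cfE normcM normc_expi mulr1 normc_real normc1 (gtr0_norm (expR_gt0 _)).
  rewrite mulNr ler_norml => /andP[h1 _].
  have q0 := Q0 (r *: evec i); set y := qform Q _ in h1 q0 *.
  have h2 := expR_ge1Dx (1 / 2 * y); have h3 := expRxMexpNx_1 (1 / 2 * y).
  have : 1 / 2 * (1 + 1 / 2 * y) <= expR (- (1 / 2 * y)) * expR (1 / 2 * y).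
    by apply: ler_pM; lra.
  rewrite [X in _ <= X]mulrC h3; lra.
move=> i j.
have Qji : Q j i = Q i j by rewrite -{1}QT mxE.
have := Q0 (evec i + 1 *: evec j); have := Q0 (evec i + (-1) *: evec j).
rewrite !qform_evec Qji => h1 h2.
have := Qii i; have := Qii j => /andP[? ?] /andP[? ?].
rewrite ler_norml; apply/andP; split; lra.
Qed.

Definition damp {R : realType} {d : nat} (sigma : R) (t : 'rV[R]_d) : R :=
  expR (- (sigma * dotv t t)).

Lemma dotv_ge0 (R : realType) (d : nat) (t : 'rV[R]_d) : 0 <= dotv t t.
Proof. by rewrite sumr_ge0 // => i _; rewrite -expr2 sqr_ge0. Qed.

Lemma damp_bounds (R : realType) (d : nat) (sigma : R) (t : 'rV[R]_d) : 0 <= sigma ->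
  [/\ 0 < damp sigma t, damp sigma t <= 1 & 1 - sigma * dotv t t <= damp sigma t].
Proof.
move=> s0; split; [exact: expR_gt0 | | exact: expR_ge1Dx].
by rewrite expR_le1 oppr_le0 mulr_ge0 // dotv_ge0.
Qed.

Lemma damp_parallelogram (R : realType) (d : nat) (sigma : R) (s t : 'rV[R]_d) :
  damp sigma (s + t) * damp sigma (s - t) = (damp sigma s * damp sigma t) ^+ 2.
Proof.
rewrite expr2 /damp -!expRD; congr expR.
by rewrite !(dotvDl, dotvDr, dotvNl, dotvNr) (dotvC t s); ring.
Qed.

Lemma dampN (R : realType) (d : nat) (sigma : R) (t : 'rV[R]_d) : damp sigma (- t) = damp sigma t.
Proof. by rewrite /damp dotvNl dotvNr opprK. Qed.

(** By [damp_parallelogram] the damping factor solves the equation exactly, so the defect is only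
    multiplied by a number at most [1]. *)
Lemma bernstein_pair_damp (R : realType) (d : nat) (f1 f2 : 'rV[R]_d -> R[i]) (eta sigma : R) :
  0 <= sigma -> bernstein_pair f1 f2 eta ->
  bernstein_pair (fun t => f1 t * (damp sigma t)%:C) (fun t => f2 t * (damp sigma t)%:C) eta.
Proof.
move=> s0 [[f10 f20] fle fN fe].
have g0 : damp sigma (0 : 'rV[R]_d) = 1.
  by rewrite /damp [dotv _ _]big1 ?mulr0 ?oppr0 ?expR0 // => i _; rewrite mxE mul0r.
have g1 (t : 'rV[R]_d) : 0 <= damp sigma t <= 1 by have [/ltW -> -> _] := damp_bounds t s0.
have nle (f : 'rV[R]_d -> R[i]) t : normc (f t) <= 1 -> normc (f t * (damp sigma t)%:C) <= 1.
  have /andP[ga gb] := g1 t.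
  by move=> ft; rewrite normcM normc_real ger0_norm // mulr_ile1 ?normc_ge0.
split.
- by rewrite f10 f20 g0 mulr1.
- by move=> t; split; apply: nle; [exact: (fle t).1 | exact: (fle t).2].
- by move=> t; rewrite dampN (fN t).1 (fN t).2 !conjcM !conjc_real.
move=> s t.
have -> : f1 (s + t) * (damp sigma (s + t))%:C * (f2 (s - t) * (damp sigma (s - t))%:C)
   - f1 s * (damp sigma s)%:C * (f2 s * (damp sigma s)%:C) *
     (f1 t * (damp sigma t)%:C * (f2 (- t) * (damp sigma (- t))%:C))
   = (f1 (s + t) * f2 (s - t) - f1 s * f2 s * (f1 t * f2 (- t))) *
     ((damp sigma s * damp sigma t) ^+ 2)%:C.
  rewrite mulrBl -{1}damp_parallelogram dampN !rmorphM; ring.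
rewrite normcM normc_real -[eta]mulr1; apply: ler_pM; rewrite ?normc_ge0 //.
have /andP[? ?] := g1 s; have /andP[? ?] := g1 t.
by rewrite ger0_norm ?sqr_ge0 // expr_le1 // ?mulr_ile1 // mulr_ge0.
Qed.

Lemma damp_near1 (R : realType) (d : nat) (sigma : R) : 0 <= sigma ->
  near1 (fun t : 'rV[R]_d => (damp sigma t)%:C).
Proof.
move=> s0 c c0; pose k : R := sigma * d%:R + 1.
have k0 : 0 < k by rewrite ltr_wpDl // mulr_ge0.
exists (Num.min 1 (c / k)) => [|t ht]; first by rewrite lt_min ltr01 divr_gt0.
set r := Num.min _ _ in ht.
have [r1 rk] : r <= 1 /\ r <= c / k by rewrite /r !ge_min !lexx orbT.
have r0 : 0 <= r by rewrite /r le_min ler01 ltW // divr_gt0.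
have dle : dotv t t <= d%:R * r.
  rewrite mulr_natl -[X in _ *+ X]card_ord -sumr_const; apply: ler_sum => i _.
  have ti : `|t ord0 i| <= r by move/inboxP: ht.
  apply: (le_trans (ler_norm _)); rewrite normrM -[r]mul1r; apply: ler_pM => //.
  exact: le_trans r1.
have [g0 g1 g2] := damp_bounds t s0.
rewrite (_ : (1 : R[i]) = (1 : R)%:C) // -rmorphB normc_real distrC ger0_norm ?subr_ge0 //.
apply: (le_trans (y := sigma * dotv t t)); first by lra.
apply: (le_trans (ler_wpM2l s0 dle)).
rewrite ler_pdivlMr // in rk; apply: le_trans rk; rewrite /k; lra.
Qed.

(** The radius is a crude bound for the square root of [sigma^-1]; only its finiteness matters. *)
Lemma damp_decay (R : realType) (d : nat) (sigma : R) (t : 'rV[R]_d) :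
  0 < sigma -> 1 / 2 <= damp sigma t -> inbox (sigma^-1 + 1) t.
Proof.
move=> s0 h; apply/inboxP => i.
have sd : sigma * dotv t t <= 1.
  have h2 := expR_ge1Dx (sigma * dotv t t); have h3 := expRxMexpNx_1 (sigma * dotv t t).
  have h4 : 0 <= sigma * dotv t t by rewrite mulr_ge0 ?dotv_ge0 // ltW.
  have : 1 / 2 * (1 + sigma * dotv t t) <= damp sigma t * expR (sigma * dotv t t).
    by apply: ler_pM; lra.
  rewrite [X in _ <= X]mulrC /damp h3; lra.
have ti : t ord0 i ^+ 2 <= sigma^-1.
  rewrite -[sigma^-1]mul1r ler_pdivlMr // mulrC; apply: le_trans sd.
  rewrite ler_pM2l // /dotv (bigD1 i) //= expr2 lerDl sumr_ge0 // => j _.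
  by rewrite -expr2 sqr_ge0.
have s1 : 0 <= sigma^-1 by rewrite invr_ge0 ltW.
rewrite -(real_normK (num_real _)) in ti; move: ti; set y := `|_| => ti.
have y0 : 0 <= y by rewrite normr_ge0.
rewrite leNgt; apply/negP => hy; nra.
Qed.

Lemma bernstein_pair_stable (R : realType) (d : nat) (f1 f2 : 'rV[R]_d -> R[i]) (eta : R) :
  bernstein_pair f1 f2 eta -> near1 f1 -> near1 f2 ->
  stab_const d * (eta + eta) <= 1 / 16 -> final_const d * eta <= 1 / 4 ->
  exists (m1 m2 : 'rV[R]_d) (Q : 'M[R]_d), [/\ Q^T = Q, (forall t, 0 <= qform Q t)
    & forall t, normc (f1 t - gauss_cf m1 Q t) <= final_const d * eta /\
                normc (f2 t - gauss_cf m2 Q t) <= final_const d * eta].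
Proof.
move=> hf n1 n2 small1 small2; have [_ fle _ _] := hf.
pose sig (n : nat) : R := n.+1%:R^-1.
have sig0 n : 0 < sig n by rewrite invr_gt0.
have sig1 n : sig n <= 1 by rewrite invf_le1 ?ler1n.
have approx n : exists p : 'rV[R]_d * 'rV[R]_d * 'M[R]_d,
    [/\ p.2^T = p.2, (forall t, 0 <= qform p.2 t)
    & forall t, normc (f1 t * (damp (sig n) t)%:C - gauss_cf p.1.1 p.2 t) <= final_const d * eta
             /\ normc (f2 t * (damp (sig n) t)%:C - gauss_cf p.1.2 p.2 t) <= final_const d * eta].
  have s0 := ltW (sig0 n).
  have [|m1 [m2 [Q hQ]]] := bernstein_pair_stable_decay (L := (sig n)^-1 + 1)
    (bernstein_pair_damp s0 hf) (near1M n1 (damp_near1 d s0)) (near1M n2 (damp_near1 d s0)) _ small1.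
    move=> t ht; apply: damp_decay => //; apply: (le_trans ht).
    rewrite normcM normc_real gtr0_norm ?expR_gt0 // ler_piMl ?(fle t).1 //.
    by rewrite ltW // expR_gt0.
  by exists (m1, m2, Q).
have [p hp] := choice approx.
(* The damping factor grows as [sigma] decreases, so a radius valid for [sigma = 1] serves all [n].
   The errors [1 / 8], [1 / 8] and [final_const d * eta <= 1 / 4] make up the [1 / 2] of
   [gauss_cf_params_bound]. *)
have bound (f : 'rV[R]_d -> R[i]) : near1 f -> (forall t, normc (f t) <= 1) ->
    exists2 r : R, 0 < r & forall n (m : 'rV[R]_d),
    (forall t, normc (f t * (damp (sig n) t)%:C - gauss_cf m (p n).2 t) <= final_const d * eta) ->
    inbox (2 / r) m /\ forall i j, `|(p n).2 i j| <= 2 / r ^+ 2.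
  move=> nf f1'; have c8 : 0 < 1 / 8 :> R by lra.
  have [r1 r10 h1] := nf _ c8; have [r2 r20 h2] := damp_near1 d (ler01 : 0 <= 1 :> R) c8.
  exists (Num.min r1 r2) => [|n m hm]; first by rewrite lt_min r10.
  have [QT Q0 _] := hp n.
  apply: gauss_cf_params_bound => // [|t ht]; first by rewrite lt_min r10.
  have {}h1 := h1 t (inboxW _ ht); have {}h2 := h2 t (inboxW _ ht).
  have {}h1 : normc (f t - 1) <= 1 / 8 by apply: h1; rewrite ge_min lexx.
  have {}h2 : normc ((damp 1 t)%:C - 1) <= 1 / 8 by apply: h2; rewrite ge_min lexx orbT.
  have [g0 g1 _] := damp_bounds t (ltW (sig0 n)).
  have g12 : damp 1 t <= damp (sig n) t.
    by rewrite ler_expR lerN2 ler_wpM2r ?dotv_ge0.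
  have {}h2 : 1 - damp (sig n) t <= 1 / 8.
    rewrite (_ : (1 : R[i]) = (1 : R)%:C) // -rmorphB normc_real ler_norml in h2.
    by case/andP: h2 => ? _; lra.
  apply: (le_trans (normc_dist (f t * (damp (sig n) t)%:C) _ _)).
  have := hm t; rewrite normc_sub => h3.
  have -> : f t * (damp (sig n) t)%:C - 1 =
     (f t - 1) - f t * (1 - damp (sig n) t)%:C by rewrite rmorphB; ring.
  have h4 : normc (f t * (1 - damp (sig n) t)%:C) <= 1 * (1 / 8).
    rewrite normcM normc_real ger0_norm ?subr_ge0 //.
    by apply: ler_pM; rewrite ?normc_ge0 ?subr_ge0.
  have := le_normcD (f t - 1) (- (f t * (1 - damp (sig n) t)%:C)); rewrite normcN.
  lra.
have [r1 r10 b1] := bound f1 n1 (fun t => (fle t).1).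
have [r2 r20 b2] := bound f2 n2 (fun t => (fle t).2).
(* The covariance is common, so its bound can be taken from [f1] alone. *)
pose B := Num.max (Num.max (2 / r1) (2 / r2)) (2 / r1 ^+ 2).
have [|||m1 [m2 [Q hlim]]] := @gauss_params_cluster R d (fun n => (p n).1.1)
    (fun n => (p n).1.2) (fun n => (p n).2) B.
- move=> n; have [_ _ hn] := hp n; have [h _] := b1 n _ (fun t => (hn t).1).
  by apply: inboxW h; rewrite /B !le_max lexx.
- move=> n; have [_ _ hn] := hp n; have [h _] := b2 n _ (fun t => (hn t).2).
  by apply: inboxW h; rewrite /B !le_max lexx orbT.
- move=> n i j; have [_ _ hn] := hp n; have [_ h] := b1 n _ (fun t => (hn t).1).
  by apply: (le_trans (h i j)); rewrite /B !le_max lexx !orbT.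
have Q0 t : 0 <= qform Q t.
  rewrite -[qform Q t]opprK oppr_ge0; apply/ler_addgt0Pr => e e0; rewrite add0r.
  have T0 : 0 < l1norm t ^+ 2 + 1 by rewrite ltr_wpDl // sqr_ge0.
  have [k _ [_ _ hQ]] := hlim (e / (l1norm t ^+ 2 + 1)) (divr_gt0 e0 T0) 0%N.
  have [_ Qk _] := hp k; have := normr_qform_le t hQ; rewrite qformB ler_norml => /andP[_ h].
  have := Qk t; move: h; set c := _ * _ => h.
  have : c <= e.
    by rewrite /c mulrAC ler_pdivrMr // ler_pM2l // lerDl.
  lra.
have QT : Q^T = Q.
  apply/matrixP => i j; rewrite mxE; apply/eqP; rewrite -subr_eq0 -normr_le0.
  apply/ler_addgt0Pr => e e0; rewrite add0r.
  have e2 : 0 < e / 2 by rewrite divr_gt0.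
  have [k _ [_ _ hQ]] := hlim _ e2 0%N; have [Tk _ _] := hp k.
  have := hQ i j; have := hQ j i; rewrite !mxE.
  have -> : (p k).2 j i = (p k).2 i j by rewrite -{1}Tk mxE.
  rewrite !ler_norml => /andP[? ?] /andP[? ?]; apply/andP; split; lra.
exists m1, m2, Q; split => //.
have close (f : 'rV[R]_d -> R[i]) (q : nat -> 'rV[R]_d) (m t : 'rV[R]_d) :
    (forall t, normc (f t) <= 1) ->
    (forall n, normc (f t * (damp (sig n) t)%:C - gauss_cf (q n) (p n).2 t)
       <= final_const d * eta) ->
    (forall e : R, 0 < e -> forall n, exists2 k, (n <= k)%N &
      inbox e (q k - m) /\ forall i j, `|((p k).2 - Q) i j| <= e) ->
    normc (f t - gauss_cf m Q t) <= final_const d * eta.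
  move=> f1' hq hcl; apply/ler_addgt0Pr => e e0.
  pose T := l1norm t ^+ 2 + 2 * l1norm t.
  have T0 : 0 <= T by rewrite addr_ge0 ?sqr_ge0 // mulr_ge0 // l1norm_ge0.
  have T1 : 0 < 2 * (T + 1) by rewrite mulr_gt0 // ltr_wpDl.
  (* From this index on the damping costs at most [e / 2]; the parameters cost the other half. *)
  pose n := Num.bound (2 * dotv t t / e).
  have [k nk [hm hQ]] := hcl (e / (2 * (T + 1))) (divr_gt0 e0 T1) n.
  have [_ Qk _] := hp k.
  have h1 := gauss_cf_dist (Qk t) (Q0 t) hm hQ; rewrite -/T in h1.
  have h1' : e / (2 * (T + 1)) * T <= e / 2.
    by rewrite mulrAC ler_pdivrMr // -mulrA [2^-1 * _]mulrA mulVf // mul1r ler_pM2l //; lra.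
  have h2 := hq k.
  have [g0 g1 g2] := damp_bounds t (ltW (sig0 k)).
  have h3 : sig k * dotv t t <= e / 2.
    have : 2 * dotv t t / e <= k.+1%:R.
      apply: ltW; apply: (lt_le_trans (y := n%:R)).
        by apply: archi_boundP; rewrite divr_ge0 ?mulr_ge0 ?dotv_ge0 // ltW.
      by rewrite ler_nat (leq_trans nk).
    rewrite ler_pdivrMr // => h4; rewrite mulrC ler_pdivrMr //; lra.
  have h4 : normc (f t - f t * (damp (sig k) t)%:C) <= 1 * (e / 2).
    have -> : f t - f t * (damp (sig k) t)%:C = f t * (1 - damp (sig k) t)%:C.
      by rewrite rmorphB; ring.
    rewrite normcM normc_real ger0_norm ?subr_ge0 //.
    by apply: ler_pM; rewrite ?normc_ge0 ?subr_ge0 //; lra.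
  apply: (le_trans (normc_dist (f t * (damp (sig k) t)%:C) _ _)).
  have := normc_dist (gauss_cf (q k) (p k).2 t) (f t * (damp (sig k) t)%:C) (gauss_cf m Q t).
  lra.
move=> t; split.
  apply: (close f1 (fun n => (p n).1.1)) => [s|n|e e0 n]; first exact: (fle s).1.
    by have [_ _ hn] := hp n; exact: (hn t).1.
  by have [k nk [? ? ?]] := hlim e e0 n; exists k.
apply: (close f2 (fun n => (p n).1.2)) => [s|n|e e0 n]; first exact: (fle s).2.
  by have [_ _ hn] := hp n; exact: (hn t).2.
by have [k nk [? ? ?]] := hlim e e0 n; exists k.
Qed.

(** * Characteristic functions *)

Lemma bounded_integrable (dT : measure_display) (T : measurableType dT) (R : realType)
    (P : probability T R) (f : T -> R) (B : R) :
  measurable_fun setT f -> (forall w, `|f w| <= B) -> P.-integrable setT (EFin \o f).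
Proof.
move=> mf fB; apply: measurable_bounded_integrable => //.
  by have := @probability_setT _ _ _ P; move=> /= ->; rewrite ltry.
exists B; split; first exact: num_real.
by move=> M BM w _; apply: (le_trans (fB w)); apply: ltW.
Qed.

Lemma integrable_cos (dT : measure_display) (T : measurableType dT) (R : realType)
    (P : probability T R) (s : T -> R) :
  measurable_fun setT s -> P.-integrable setT (EFin \o (fun w => cos (s w))).
Proof.
move=> ms; apply: (@bounded_integrable _ _ _ P _ 1) => [|w]; last exact: cos_max.
apply: (measurableT_comp _ ms); exact: (continuous_measurable_fun (@continuous_cos R)).
Qed.

Lemma integrable_sin (dT : measure_display) (T : measurableType dT) (R : realType)
    (P : probability T R) (s : T -> R) :
  measurable_fun setT s -> P.-integrable setT (EFin \o (fun w => sin (s w))).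
Proof.
move=> ms; apply: (@bounded_integrable _ _ _ P _ 1) => [|w]; last exact: sin_max.
apply: (measurableT_comp _ ms); exact: (continuous_measurable_fun (@continuous_sin R)).
Qed.

Lemma Rintegral_prob_cst (dT : measure_display) (T : measurableType dT) (R : realType)
    (P : probability T R) (c : R) : Rintegral P setT (fun=> c) = c.
Proof. by rewrite Rintegral_cst //; have := @probability_setT _ _ _ P => /= ->; rewrite mulr1. Qed.

(* Integrating [cos s * a + sin s * b <= normc z] for [z = a +i* b] the expectation itself. *)
Lemma normc_cexpect_le1 (dT : measure_display) (T : measurableType dT) (R : realType)
    (P : probability T R) (s : T -> R) :
  measurable_fun setT s -> normc (cexpect P s) <= 1.
Proof.
move=> ms; set z := cexpect P s; have ic := integrable_cos P ms; have is_ := integrable_sin P ms.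
pose a := complex.Re z; pose b := complex.Im z.
have zE : normc z ^+ 2 = a ^+ 2 + b ^+ 2.
  by rewrite /= sqr_sqrtr // addr_ge0 ?sqr_ge0.
have : Rintegral P setT (fun w => a * cos (s w) + b * sin (s w)) <= Rintegral P setT (fun=> normc z).
  apply: le_Rintegral => //.
  - exact: (integrableD measurableT (integrableZl measurableT a ic) (integrableZl measurableT b is_)).
  - by apply: (@bounded_integrable _ _ _ P _ `|normc z|) => // w; rewrite ler_norm.
  - move=> w _.
    have := normc_Re (z * expi (- s w)); rewrite normcM normc_expi mulr1.
    apply: le_trans; apply: le_trans (ler_norm _).
    by rewrite /expi cosN sinN /a /b; case: (z) => x y /=; rewrite mulrN opprK.
rewrite RintegralD // ?RintegralZl //; last 2 first.
- exact: (integrableZl measurableT a ic).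
- exact: (integrableZl measurableT b is_).
rewrite Rintegral_prob_cst -/a -/b -!expr2 -zE.
have := normc_ge0 z; set n := normc z => n0 h.
rewrite leNgt; apply/negP => n1; nra.
Qed.

Lemma conj_cexpect (dT : measure_display) (T : measurableType dT) (R : realType)
    (P : probability T R) (s : T -> R) :
  measurable_fun setT s -> cexpect P (fun w => - s w) = conjc (cexpect P s).
Proof.
move=> ms; rewrite /cexpect /=; congr (_ +i* _).
  by apply: eq_Rintegral => w _; rewrite cosN.
rewrite -mulN1r -RintegralZl //; last exact: integrable_sin.
by apply: eq_Rintegral => w _; rewrite sinN mulN1r.
Qed.

Lemma measurable_dotv (dT : measure_display) (T : measurableType dT) (R : realType)
    (d : nat) (X : T -> 'rV[R]_d) (t : 'rV[R]_d) :
  rand_vec d X -> measurable_fun setT (fun w => dotv t (X w)).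
Proof.
move=> mX; apply: measurable_sum => i.
by apply: measurable_funM => //; apply: mX.
Qed.

Lemma charfun0 (dT : measure_display) (T : measurableType dT) (R : realType)
    (P : probability T R) (d : nat) (X : T -> 'rV[R]_d) : charfun P X 0 = 1.
Proof.
have z w : dotv 0 (X w) = 0 by rewrite /dotv big1 // => i _; rewrite mxE mul0r.
rewrite /charfun /cexpect [RHS](_ : _ = 1 +i* 0) //; congr (_ +i* _).
  rewrite -[RHS](Rintegral_prob_cst P); apply: eq_Rintegral => w _.
  by rewrite z cos0.
rewrite -[RHS](Rintegral_prob_cst P); apply: eq_Rintegral => w _.
by rewrite z sin0.
Qed.

(** Dominated convergence. [Z] may fail to be integrable, so the truncation at [2], the diameter of
    the unit circle, supplies the dominating function. *)
Lemma Rintegral_min_small (dT : measure_display) (T : measurableType dT) (R : realType)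
    (P : probability T R) (Z : T -> R) (c : R) :
  measurable_fun setT Z -> (forall w, 0 <= Z w) -> 0 < c ->
  exists n : nat, Rintegral P setT (fun w => Num.min 2 (Z w / n.+1%:R)) < c.
Proof.
move=> mZ Z0 c0.
pose f (n : nat) w := (Num.min 2 (Z w / n.+1%:R))%:E.
have f0 n w : 0 <= Num.min 2 (Z w / n.+1%:R) by rewrite le_min ler0n divr_ge0.
have mf n : measurable_fun setT (f n).
  apply/measurable_EFinP; apply: measurable_minr => //.
  exact: (measurable_funM mZ (measurable_cst _)).
have fcvg w : setT w -> f ^~ w @ \oo --> (0 : R)%:E.
  move=> _; apply: cvg_EFin; first by near=> n.
  apply: (@squeeze_cvgr _ _ _ _ (fun=> 0) (fun n => Z w * n.+1%:R^-1)).
  - by near=> n; rewrite /= f0 ge_min lexx orbT.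
  - exact: cvg_cst.
  - rewrite -[X in _ --> X](mulr0 (Z w)); apply: cvgM; first exact: cvg_cst.
    exact: cvg_harmonic.
have i2 : P.-integrable setT (EFin \o (fun=> 2 : R)).
  by apply: (@bounded_integrable _ _ _ P _ 2) => // w; rewrite ger0_norm.
have := @dominated_cvg _ _ _ P setT measurableT f (fun=> 0%:E) (EFin \o (fun=> 2)) mf fcvg.
move=> /(_ (fun _ _ => isT) i2) H; rewrite integral0 in H.
have /fine_cvg /cvgrPdist_lt /(_ c c0)[n _ /(_ n (leqnn n))] : (fun n => (\int[P]_w f n w)%E) @ \oo --> (0:R)%:E.
  by apply: H => n w _; rewrite /f /= lee_fin ger0_norm // ge_min lexx.
rewrite /= sub0r normrN => h; exists n; apply: le_lt_trans h; exact: ler_norm.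
Unshelve. all: by end_near. Qed.

(** The distance of [expi (dotv t (X w))] from [1] is at most both [2] and [2 * l1norm (X w)] times
    the radius of the box; no moment of [X] enters. *)
Lemma charfun_near1 (dT : measure_display) (T : measurableType dT) (R : realType)
    (P : probability T R) (d : nat) (X : T -> 'rV[R]_d) :
  rand_vec d X -> near1 (charfun P X).
Proof.
move=> mX c c0.
pose Z w := 2 * l1norm (X w).
have mZ : measurable_fun setT Z.
  apply: measurable_funM; first exact: measurable_cst.
  by apply: measurable_sum => i; apply: measurableT_comp => //; apply: mX.
have Z0 w : 0 <= Z w by rewrite mulr_ge0 // l1norm_ge0.
have c2 : 0 < c / 2 by rewrite divr_gt0.
have [n hn] := Rintegral_min_small P mZ Z0 c2.
exists n.+1%:R^-1 => [|t ht]; first by rewrite invr_gt0.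
pose psi w := Num.min 2 (Z w / n.+1%:R).
have mpsi : measurable_fun setT psi.
  apply: measurable_minr => //; exact: (measurable_funM mZ (measurable_cst _)).
have psi0 w : 0 <= psi w by rewrite le_min ler0n divr_ge0.
have ipsi : P.-integrable setT (EFin \o psi).
  by apply: (@bounded_integrable _ _ _ P _ 2) => // w; rewrite ger0_norm // ge_min lexx.
have mdot := measurable_dotv t mX.
have ic := integrable_cos P mdot; have is_ := integrable_sin P mdot.
have i1 : P.-integrable setT (EFin \o (fun=> 1 : R)).
  by apply: (@bounded_integrable _ _ _ P _ 1) => // w; rewrite normr1.
have hpsi w : normc (expi (dotv t (X w)) - 1) <= psi w.
  rewrite le_min; apply/andP; split.
    apply: (le_trans (le_normcD _ _)); rewrite normcN normc_expi normc1; lra.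
  have := normc_expi_dist (dotv t (X w)) 0; rewrite expi0 subr0 => h.
  apply: (le_trans h); rewrite /Z -mulrA ler_pM2l // mulrC dotvC.
  exact: normr_dotv_le.
have small (f : T -> R) : P.-integrable setT (EFin \o f) ->
    (forall w, `|f w| <= psi w) -> `|Rintegral P setT f| <= c / 2.
  move=> intf fpsi; apply: le_trans (ltW hn).
  apply: (le_trans (le_normr_Rintegral measurableT intf)).
  apply: le_Rintegral => //.
  exact: (integrable_abse intf).
have -> : charfun P X t - 1 = (Rintegral P setT (fun w => cos (dotv t (X w)) - 1))
    +i* (Rintegral P setT (fun w => sin (dotv t (X w)))).
  rewrite RintegralB // Rintegral_prob_cst /charfun /cexpect.
  by rewrite (_ : (1 : R[i]) = 1 +i* 0) //; simpc.
apply: (le_trans (normc_leD _ _)).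
have -> : c = c / 2 + c / 2 by field.
apply: lerD; apply: small => //.
- exact: (integrableB measurableT ic i1).
- move=> w; apply: le_trans (hpsi w); have := normc_Re (expi (dotv t (X w)) - 1).
  by rewrite /expi raddfB.
- move=> w; apply: le_trans (hpsi w); have := normc_Im (expi (dotv t (X w)) - 1).
  by rewrite /expi raddfB /= subr0.
Qed.

Lemma ler_normc (R : realType) (z : R[i]) (c : R) : (`|z| <= c%:C) = (normc z <= c).
Proof. by rewrite normc_def lecR; case: z. Qed.

Lemma bernstein_pair_charfun (dT : measure_display) (T : measurableType dT) (R : realType)
    (P : probability T R) (d : nat) (X1 X2 : T -> 'rV[R]_d) (eps delta : R) :
  rand_vec d X1 -> rand_vec d X2 -> 0 <= delta ->
  eps_dependent P delta X1 X2 ->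
  eps_dependent P eps (fun w => X1 w + X2 w) (fun w => X1 w - X2 w) ->
  bernstein_pair (charfun P X1) (charfun P X2) (eps + 4 * delta).
Proof.
move=> m1 m2 delta0 hX hS.
have le1 (X : T -> 'rV[R]_d) t : rand_vec d X -> normc (charfun P X t) <= 1.
  by move=> mX; apply/normc_cexpect_le1/measurable_dotv.
have fN (X : T -> 'rV[R]_d) t : rand_vec d X -> charfun P X (- t) = conjc (charfun P X t).
  move=> mX; rewrite -conj_cexpect; last exact: measurable_dotv.
  by congr cexpect; apply/funext => w; rewrite dotvNl.
split.
- by rewrite !charfun0.
- by move=> t; split; apply: le1.
- by move=> t; split; apply: fN.
move=> s t.
(* [h4] splits the joint transform into those of sum and difference, [h2] and [h3] split each of
   these into [f1] and [f2], and [h1] splits the joint transform directly: [eps + 3 * delta] in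
   all. *)
have h1 := hX (s + t) (s - t); have h2 := hX s s; have h3 := hX t (- t); have h4 := hS s t.
move: h1 h2 h3 h4; rewrite !ler_normc => h1 h2 h3 h4.
set U := fun w => X1 w + X2 w in h4; set V := fun w => X1 w - X2 w in h4.
have e1 : (fun w => dotv s (U w) + dotv t (V w))
    = (fun w => dotv (s + t) (X1 w) + dotv (s - t) (X2 w)).
  by apply/funext => w; rewrite !(dotvDl, dotvDr, dotvNl, dotvNr); ring.
have e2 : cexpect P (fun w => dotv s (X1 w) + dotv s (X2 w)) = charfun P U s.
  by congr cexpect; apply/funext => w; rewrite dotvDr.
have e3 : cexpect P (fun w => dotv t (X1 w) + dotv (- t) (X2 w)) = charfun P V t.
  by congr cexpect; apply/funext => w; rewrite dotvDr dotvNr dotvNl.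
rewrite e1 in h4; rewrite e2 in h2; rewrite e3 in h3.
have mV : rand_vec d V by move=> k; apply: eq_measurable_fun (measurable_funB (m1 k) (m2 k)) => w _; rewrite !mxE.
have h5 : normc (charfun P U s * charfun P V t
    - charfun P X1 s * charfun P X2 s * (charfun P X1 t * charfun P X2 (- t))) <= delta + delta.
  apply: normcM_dist_le1 => //; first exact: le1.
  by rewrite normcM mulr_ile1 ?normc_ge0 ?le1.
apply: (le_trans (normc_dist (charfun P U s * charfun P V t) _ _)).
have h6 := normc_dist (cexpect P (fun w => dotv (s + t) (X1 w) + dotv (s - t) (X2 w)))
   (charfun P X1 (s + t) * charfun P X2 (s - t)) (charfun P U s * charfun P V t).
rewrite (normc_sub (cexpect _ _)) in h1; lra.
Qed.

(** At [eps = delta = 0] the bounds vanish and both characteristic functions are Gaussian with the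
    same [Q]: Bernstein's characterisation. *)
Theorem theorem5 (R : realType) (d : nat) :
  exists (eta0 : R) (C : R), 0 < eta0 /\
  forall (dT : measure_display) (T : measurableType dT) (P : probability T R)
         (X1 X2 : T -> 'rV[R]_d) (eps delta : R),
    rand_vec d X1 -> rand_vec d X2 ->
    0 <= eps -> 0 <= delta -> eps + 4 * delta < eta0 ->
    eps_dependent P delta X1 X2 ->
    eps_dependent P eps (fun w => X1 w + X2 w) (fun w => X1 w - X2 w) ->
    exists (m1 m2 : 'rV[R]_d) (Q : 'M[R]_d),
      sym_psd Q /\
      forall t : 'rV[R]_d,
        `| charfun P X1 t - gauss_cf m1 Q t | <= (C * (eps + 4 * delta))%:C /\
        `| charfun P X2 t - gauss_cf m2 Q t | <= (C * (eps + 4 * delta))%:C.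
Proof.
have S0 : 0 <= stab_const d :> R.
  by rewrite mulr_ge0 ?exprn_ge0 // addr_ge0 // /box_const ler0n.
have k0 : 0 < 32 * stab_const d + 4 :> R by lra.
(* The [32] yields [stab_const d * (eta + eta) <= 1 / 16]; with the [4] also
   [final_const d * eta <= 1 / 4]. *)
exists (32 * stab_const d + 4)^-1, (final_const d); split; first by rewrite invr_gt0.
move=> dT T P X1 X2 eps delta m1 m2 eps0 delta0 small hX hS.
have hb := bernstein_pair_charfun m1 m2 delta0 hX hS.
have eta0 : 0 <= eps + 4 * delta by lra.
set eta := eps + 4 * delta in small hb eta0 *.
have {}small : (32 * stab_const d + 4) * eta <= 1.
  by rewrite mulrC -ler_pdivlMr // div1r ltW.
have Se : 0 <= stab_const d * eta by rewrite mulr_ge0.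
have [||l1 [l2 [Q [QT Q0 hQ]]]] :=
    bernstein_pair_stable hb (charfun_near1 P m1) (charfun_near1 P m2).
- lra.
- rewrite /final_const; lra.
exists l1, l2, Q; split => // t.
by rewrite !ler_normc; exact: hQ.
Qed.
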